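(* Let $A$ be a locally compact abelian group. (i) There is an open embedding $A \hookrightarrow D$ with $D$ a divisible locally compact abelian group and $D/A$ torsion. (ii) If $A \in \mathsf{FLCAb}$, then we can achieve $D \in \mathsf{FLCAb}$ in (i). (iii) If $A \in \mathsf{P}$, then we can achieve $D = \mathbb{Q}^r \oplus \mathbb{R}^s \oplus \prod'_p (\mathbb{Q}_p^{r_p} : \mathbb{Z}_p^{r_p})$ in (i), for some nonnegative integers $r$, $s$ and $r_p$ ($p$ prime).
   Context: LCA group means locally compact (Hausdorff) abelian group; $\mathrm{Hom}$ denotes continuous homomorphisms, $\mathbb{S}^1=\mathbb{R}/\mathbb{Z}$ and $A^{\vee} = \mathrm{Hom}(A, \mathbb{S}^1)$ is the Pontryagin dual. A morphism $f: A\to B$ of LCA groups is strict if the induced map $A/\ker(f) \to B$ is a closed embedding. An LCA group is divisible if multiplication by $n$ is surjective for all integers $n \ge 1$, and codivisible if its Pontryagin dual is divisible. $A$ has finite ranks if the real vector spaces $\mathrm{Hom}(A, \mathbb{R})$ and $\mathrm{Hom}(\mathbb{R}, A)$ are finite-dimensional and, for every prime $p$, multiplication $p: A \to A$ is strict with finite kernel and cokernel. $\mathsf{FLCAb}$ is the category of LCA groups having finite ranks. Every LCA group $A$ has a unique chain of closed subgroups $0 \subseteq A_{\mathbb{S}^1} \subseteq F_{\mathbb{Z}} A \subseteq A$ such that $A_{\mathbb{S}^1}$ is compact and connected, $A/F_{\mathbb{Z}} A$ is discrete and torsionfree, and $F_{\mathbb{Z}} A/A_{\mathbb{S}^1}$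 is isomorphic to a direct sum of some $\mathbb{R}^m$ and a topological torsion group (an LCA group $T$ with $\lim_{k\to\infty} k!\,t = 0$ for all $t \in T$). $\mathsf{P}$ is the full subcategory of $\mathsf{FLCAb}$ of codivisible $P$ with $P_{\mathbb{S}^1} = 0$. $\prod'_p(\mathbb{Q}_p^{r_p}:\mathbb{Z}_p^{r_p})$ is the restricted product over all primes with respect to the compact open subgroups $\mathbb{Z}_p^{r_p}$; $\mathbb{Q}$ is discrete. *)

(* Defs.v *)
From HB Require Import structures.
From mathcomp Require Import all_boot all_order all_algebra zify ring lra.
From mathcomp Require Import all_classical all_reals topology normedtype.

Set Implicit Arguments.
Unset Strict Implicit.
Unset Printing Implicit Defensive.

Import Order.TTheory GRing.Theory Num.Theory.
Import numFieldNormedType.Exports.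

Local Open Scope classical_set_scope.
Local Open Scope ring_scope.

(* Abelian topological groups are MathComp-Analysis' [topologicalZmodType];   *)
(* subgroups of A are elements of [zmodClosed A], which are boolean           *)
(* predicates: for H a subgroup, [set` H] is its underlying set.              *)

Definition LCA (A : topologicalZmodType) : Prop :=
  hausdorff_space A /\ locally_compact [set: A].

Definition discrete (T : topologicalType) : Prop := forall U : set T, open U.

Definition divisible (G : zmodType) : Prop :=
  forall n, (0 < n)%N -> forall x : G, exists y : G, y *+ n = x.

Definition torsion (G : zmodType) : Prop :=
  forall x : G, exists2 n, (0 < n)%N & x *+ n = 0.

Definition torsionfree (G : zmodType) : Prop :=
  forall (x : G) n, (0 < n)%N -> x *+ n = 0 -> x = 0.

Definition finite_dimensional (K : fieldType) (V : lmodType K) : Prop :=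
  exists n (e : 'I_n -> V), forall v, exists c : 'I_n -> K,
    v = \sum_(i < n) c i *: e i.

Lemma continuous_pair_near (T U V : topologicalType) (f : T * U -> V) :
  (forall x y (W : set V), open W -> W (f (x, y)) ->
    exists P Q, [/\ nbhs x P, nbhs y Q &
      forall a b, P a -> Q b -> W (f (a, b))]) ->
  continuous f.
Proof.
move=> H [x y] W; rewrite nbhsE => -[W' [oW' W'f] W'W].
have [P [Q [xP yQ PQ]]] := H x y W' oW' W'f.
exists (P, Q); first by split.
by move=> [a b] [/= Pa Qb]; apply: W'W; exact: PQ.
Qed.

Lemma sub_near (A : topologicalZmodType) (x y : A) (W : set A) :
  nbhs (x - y) W -> exists P Q, [/\ nbhs x P, nbhs y Q &
      forall a b, P a -> Q b -> W (a - b)].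
Proof.
move=> /(@sub_continuous A (x, y)) [[P Q] [/= xP yQ] PQ].
by exists P, Q; split => // a b Pa Qb; exact: (PQ (a, b)).
Qed.

Lemma add_near (A : topologicalZmodType) (x y : A) (W : set A) :
  nbhs (x + y) W -> exists P Q, [/\ nbhs x P, nbhs y Q &
      forall a b, P a -> Q b -> W (a + b)].
Proof.
move=> /(@add_continuous A (x, y)) [[P Q] [/= xP yQ] PQ].
by exists P, Q; split => // a b Pa Qb; exact: (PQ (a, b)).
Qed.

(* An alias of the product type: on [prod] itself the library already has a   *)
(* group topology for topological vector spaces only.                         *)
Definition dsum (A B : Type) : Type := (A * B)%type.

Section Dsum.
Variables A B : topologicalZmodType.
HB.instance Definition _ := Topological.copy (dsum A B) (A * B)%type.
HB.instance Definition _ := GRing.Zmodule.copy (dsum A B) (A * B)%type.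

Lemma dsum_sub_continuous :
  continuous (fun x : dsum A B * dsum A B => x.1 - x.2).
Proof.
apply: continuous_pair_near => -[x1 x2] [y1 y2] W oW Wxy.
have [[W1 W2] [/= n1 n2] W12] : nbhs ((x1, x2) - (y1, y2) : dsum A B) W.
  by apply: open_nbhs_nbhs; split.
have [P1 [Q1 [P1x Q1y PQ1]]] := sub_near n1.
have [P2 [Q2 [P2x Q2y PQ2]]] := sub_near n2.
exists (P1 `*` P2), (Q1 `*` Q2); split.
- by exists (P1, P2).
- by exists (Q1, Q2).
- move=> [a1 a2] [b1 b2] [/= ? ?] [/= ? ?]; apply: W12; split => /=.
    exact: PQ1.
  exact: PQ2.
Qed.

HB.instance Definition _ :=
  PreTopologicalNmodule_isTopologicalZmodule.Build (dsum A B)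
    dsum_sub_continuous.
End Dsum.

Definition gprod (I : Type) (G : I -> Type) : Type := prod_topology G.

Section Gprod.
Variables (I : Type) (G : I -> topologicalZmodType).
HB.instance Definition _ := Topological.copy (gprod G) (prod_topology G).

Let gadd (f g : gprod G) : gprod G := fun i => f i + g i.
Let gopp (f : gprod G) : gprod G := fun i => - f i.
Let g0 : gprod G := fun i => 0.

Let gaddA : associative gadd.
Proof. by move=> f g h; apply: functional_extensionality_dep => i; exact: addrA. Qed.
Let gaddC : commutative gadd.
Proof. by move=> f g; apply: functional_extensionality_dep => i; exact: addrC. Qed.
Let gadd0 : left_id g0 gadd.
Proof. by move=> f; apply: functional_extensionality_dep => i; exact: add0r. Qed.
Let gaddN : left_inverse g0 gopp gadd.
Proof. by move=> f; apply: functional_extensionality_dep => i; exact: addNr. Qed.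

HB.instance Definition _ :=
  GRing.isZmodule.Build (gprod G) gaddA gaddC gadd0 gaddN.

Lemma gprodD (f g : gprod G) i : (f + g) i = f i + g i. Proof. by []. Qed.
Lemma gprodN (f : gprod G) i : (- f) i = - f i. Proof. by []. Qed.
Lemma gprodB (f g : gprod G) i : (f - g) i = f i - g i. Proof. by []. Qed.
Lemma gprod0 i : (0 : gprod G) i = 0. Proof. by []. Qed.

Lemma gprod_cvgP (F : set_system (gprod G)) (f : gprod G) : Filter F ->
  F --> f <-> forall i (U : set (G i)), nbhs (f i) U -> F [set g | U (g i)].
Proof.
move=> FF; split.
  move=> Ff i U; rewrite nbhsE => -[V [oV Vf] VU].
  move/cvg_sup : Ff => /(_ i); apply => /=.
  exists [set g : gprod G | V (g i)]; split; first by exists V.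
  - exact: Vf.
  - by move=> g /= /VU.
move=> H; apply/cvg_sup => i W [V [[V' oV' <-] V'f] V'W].
rewrite nbhs_filterE; apply: (filterS V'W).
by apply: H; apply: open_nbhs_nbhs; split.
Qed.

Lemma gprod_proj_near (f : gprod G) i (U : set (G i)) :
  nbhs (f i) U -> nbhs f [set g : gprod G | U (g i)].
Proof. by move: i U; apply/gprod_cvgP; exact: cvg_id. Qed.

Lemma gprod_sub_continuous :
  continuous (fun x : gprod G * gprod G => x.1 - x.2).
Proof.
move=> [f g]; apply/gprod_cvgP => i U /= fgU.
have [P [Q [fP gQ PQ]]] := sub_near fgU.
exists ([set h : gprod G | P (h i)], [set h : gprod G | Q (h i)]).
  by split; exact: gprod_proj_near.
by move=> [a b] [/= Pa Qb]; exact: PQ.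
Qed.

HB.instance Definition _ :=
  PreTopologicalNmodule_isTopologicalZmodule.Build (gprod G)
    gprod_sub_continuous.
End Gprod.

Definition gpow (A : Type) (n : nat) : Type := gprod (fun _ : 'I_n => A).
HB.instance Definition _ (A : topologicalZmodType) n :=
  TopologicalZmodule.on (gpow A n).

Section Subgroup.
Variables (A : topologicalZmodType) (H : zmodClosed A).

Record subgroup := Subgroup { sgval : A; sgvalP : sgval \in H }.

HB.instance Definition _ := [isSub for sgval].
HB.instance Definition _ := [Choice of subgroup by <:].
HB.instance Definition _ := [SubChoice_isSubZmodule of subgroup by <:].
HB.instance Definition _ :=
  Topological.copy subgroup (initial_topology sgval).

Lemma subgroup_nearP (x : subgroup) (W : set subgroup) :
  nbhs x W <-> exists2 V, nbhs (sgval x) V & sgval @^-1` V `<=` W.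
Proof.
split.
  move=> [V [[V' oV' <-] V'x] V'W]; exists V' => //.
  by apply: open_nbhs_nbhs; split.
move=> [V]; rewrite nbhsE => -[V' [oV' V'x] V'V] VW.
exists (sgval @^-1` V'); split => //; first by exists V'.
by move=> y /V'V /VW.
Qed.

Lemma subgroup_sub_continuous :
  continuous (fun x : subgroup * subgroup => x.1 - x.2).
Proof.
apply: continuous_pair_near => x y W oW Wxy.
have /subgroup_nearP [V nV VW] : nbhs (x - y) W by apply: open_nbhs_nbhs; split.
have [P [Q [xP yQ PQ]]] := sub_near (nV : nbhs (sgval x - sgval y) V).
exists (sgval @^-1` P), (sgval @^-1` Q); split.
- by apply/subgroup_nearP; exists P.
- by apply/subgroup_nearP; exists Q.
- by move=> a b Pa Qb; apply: VW; exact: PQ.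
Qed.

HB.instance Definition _ :=
  PreTopologicalNmodule_isTopologicalZmodule.Build subgroup
    subgroup_sub_continuous.

End Subgroup.

Section Quotient.
Variables (A : topologicalZmodType) (H : zmodClosed A).
Local Open Scope quotient_scope.

Definition gquot : Type := quotient_topology (Quotient.quot H).

HB.instance Definition _ := Topological.on gquot.
HB.instance Definition _ := Quotient.on gquot.
HB.instance Definition _ := GRing.isZmodule.Build gquot
  (@Quotient.addqA A H) (@Quotient.addqC A H)
  (@Quotient.add0q A H) (@Quotient.addNq A H).

Definition gproj (x : A) : gquot := \pi_gquot x.

Lemma gprojD x y : gproj (x + y) = gproj x + gproj y.
Proof. exact: (@Quotient.pi_add A H). Qed.

Lemma gprojN x : gproj (- x) = - gproj x.
Proof. exact: (@Quotient.pi_opp A H). Qed.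

Lemma gprojB x y : gproj (x - y) = gproj x - gproj y.
Proof. by rewrite gprojD gprojN. Qed.

Lemma gproj0 : gproj 0 = 0.
Proof. by rewrite -(subrr 0) gprojB subrr. Qed.

Lemma gproj_eq x y : gproj x = gproj y <-> x - y \in H.
Proof.
rewrite (@Quotient.idealrBE A H).
by split => [e|/eqP e]; [apply/eqP; exact: e|exact: e].
Qed.

Lemma gproj_surj (q : gquot) : exists x, gproj x = q.
Proof. by exists (repr q); exact: reprK. Qed.

Lemma gproj_near (x : A) (W : set gquot) :
  nbhs (gproj x) W <-> nbhs x (gproj @^-1` W).
Proof.
split; first exact: (@pi_continuous A (Quotient.quot H) x).
rewrite nbhsE => -[V [oV Vx] VW].
exists (gproj @` V); split; last by move=> _ [v Vv <-]; exact: VW.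
- rewrite /open/= /quotient_open.
  rewrite (_ : _ @^-1` _ =
    \bigcup_(h in [set` H]) (fun a : A => a - h) @^-1` V); last first.
    apply/seteqP; split => [a [v Vv /esym/gproj_eq avH]|a [h /= hH Vah]].
      by exists (a - v) => //=; rewrite opprB addrC subrK.
    by exists (a - h) => //; apply/esym/gproj_eq; rewrite opprB addrC subrK.
  apply: bigcup_open => h _; move: V oV {Vx VW}; apply/continuousP => a U.
  move=> /sub_near[P [Q [aP hQ PQ]]]; apply: filterS aP => b Pb.
  by apply: PQ => //; exact: nbhs_singleton.
- by exists x.
Qed.

Lemma gquot_sub_continuous :
  continuous (fun x : gquot * gquot => x.1 - x.2).
Proof.
apply: continuous_pair_near => x y W oW Wxy.
have [x' x'E] := gproj_surj x; have [y' y'E] := gproj_surj y.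
have nW : nbhs (gproj (x' - y')) W.
  by rewrite gprojB x'E y'E; apply: open_nbhs_nbhs; split.
have [P [Q [xP yQ PQ]]] := sub_near (proj1 (gproj_near _ _) nW).
exists (gproj @` P), (gproj @` Q); split.
- rewrite -x'E; apply/gproj_near; apply: filterS xP => a Pa; exact: imageP.
- rewrite -y'E; apply/gproj_near; apply: filterS yQ => a Qa; exact: imageP.
- by move=> _ _ [a Pa <-] [b Qb <-] /=; rewrite -gprojB; exact: PQ.
Qed.

HB.instance Definition _ :=
  PreTopologicalNmodule_isTopologicalZmodule.Build gquot gquot_sub_continuous.

End Quotient.

Section Hom.
Variables A B : topologicalZmodType.

Definition is_chom : {pred A -> B} :=
  fun f => `[< continuous f /\ zmod_morphism f >].

Record chom := Chom { chom_fun :> A -> B; chom_is_chom : chom_fun \in is_chom }.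

HB.instance Definition _ := [isSub for chom_fun].
HB.instance Definition _ := [Choice of chom by <:].

Lemma chom_continuous (f : chom) : continuous f.
Proof. by case: f => f /= /asboolP[]. Qed.

Lemma chomB (f : chom) : {morph f : x y / x - y}.
Proof. by case: f => f /= /asboolP[_ +] x y; exact. Qed.

Lemma chom0 (f : chom) : f 0 = 0.
Proof. by rewrite -(subrr 0) chomB subrr. Qed.

Lemma chomN (f : chom) : {morph f : x / - x}.
Proof. by move=> x; rewrite -sub0r chomB chom0 sub0r. Qed.

Lemma chomD (f : chom) : {morph f : x y / x + y}.
Proof. by move=> x y; rewrite -{1}[y]opprK chomB chomN opprK. Qed.

Lemma is_chom_zmod_closed : zmod_closed is_chom.
Proof.
split=> [|f g /asboolP[fc fm] /asboolP[gc gm]]; apply/asboolP; split.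
- by move=> x; exact: cvg_cst.
- by move=> x y; rewrite subr0.
- move=> x W /sub_near[P [Q [fP gQ PQ]]].
  have {}fP : nbhs x (f @^-1` P) by exact: fc.
  have {}gQ : nbhs x (g @^-1` Q) by exact: gc.
  change (nbhs x ((f - g) @^-1` W)).
  by apply: filterS (filterI fP gQ) => a [Pa Qa]; exact: PQ.
- move=> x y; have E z : (f - g) z = f z - g z by [].
  by rewrite !E fm gm !opprD !opprK addrACA.
Qed.

HB.instance Definition _ :=
  GRing.isZmodClosed.Build (A -> B) is_chom is_chom_zmod_closed.
HB.instance Definition _ := [SubChoice_isSubZmodule of chom by <:].

End Hom.

Lemma muln_is_chom (A : topologicalZmodType) n :
  (fun x : A => x *+ n) \in @is_chom A A.
Proof.
apply/asboolP; split; last by move=> x y; exact: mulrnBl.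
elim: n => [|n IHn]; first exact: (@cst_continuous A A 0).
move=> x W; rewrite mulrS => /add_near[P [Q [xP nQ PQ]]].
have {}nQ : nbhs x ((fun y => y *+ n) @^-1` Q) by exact: IHn.
change (nbhs x ((fun y => y *+ n.+1) @^-1` W)).
apply: filterS (filterI xP nQ) => a [Pa Qa].
by rewrite /= mulrS; exact: PQ.
Qed.

Definition chom_muln (A : topologicalZmodType) n : chom A A :=
  Chom (muln_is_chom A n).

Section HomLmodule.
Variables (K : numDomainType) (A : topologicalZmodType).
Variable (V : topologicalLmodType K).

Let chom_scale_subproof (c : K) (f : chom A V) :
  (fun x => c *: f x) \in @is_chom A V.
Proof.
apply/asboolP; split; last by move=> x y; rewrite chomB scalerBr.
move=> x; apply: (@continuous_comp _ _ _ (fun x => (c, f x) : K^o * V)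
  (fun z : K^o * V => z.1 *: z.2)); last exact: scale_continuous.
apply: (@cvg_pair _ _ _ _ (nbhs (c : K^o)) (nbhs (f x)));
  [exact: cvg_cst|exact: chom_continuous].
Qed.

Let chom_scale c f : chom A V := Chom (chom_scale_subproof c f).

Let chom_scaleA a b v : chom_scale a (chom_scale b v) = chom_scale (a * b) v.
Proof. by apply/val_inj/funext => x /=; rewrite scalerA. Qed.
Let chom_scale1 : left_id 1 chom_scale.
Proof. by move=> v; apply/val_inj/funext => x /=; rewrite scale1r. Qed.
Let chom_scaleDr : right_distributive chom_scale +%R.
Proof. by move=> a u v; apply/val_inj/funext => x /=; rewrite scalerDr. Qed.
Let chom_scaleDl v : {morph chom_scale^~ v : a b / a + b}.
Proof. by move=> a b; apply/val_inj/funext => x /=; rewrite scalerDl. Qed.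

HB.instance Definition _ := GRing.Zmodule_isLmodule.Build K (chom A V)
  chom_scaleA chom_scale1 chom_scaleDr chom_scaleDl.
End HomLmodule.

(* Hom(R, A) is a real vector space for the scaling (c f)(x) = f (c x). *)
Definition one_param (R : realType) (A : topologicalZmodType) : Type :=
  chom R A.

Section OneParam.
Variables (R : realType) (A : topologicalZmodType).
HB.instance Definition _ := GRing.Zmodule.on (one_param R A).

Let op_scale_subproof (c : R) (f : chom R A) :
  (fun x => f (c * x)) \in @is_chom R A.
Proof.
apply/asboolP; split; last by move=> x y; rewrite mulrBr chomB.
move=> x; apply: (@continuous_comp _ _ _ ( *%R c) f).
  exact: mulrl_continuous.
exact: chom_continuous.
Qed.

Let op_scale c (f : one_param R A) : one_param R A :=
  Chom (op_scale_subproof c f).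

Let op_scaleA a b v : op_scale a (op_scale b v) = op_scale (a * b) v.
Proof. by apply/val_inj/funext => x /=; rewrite mulrA [b * a]mulrC. Qed.
Let op_scale1 : left_id 1 op_scale.
Proof. by move=> v; apply/val_inj/funext => x /=; rewrite mul1r. Qed.
Let op_scaleDr : right_distributive op_scale +%R.
Proof. by move=> a u v; apply/val_inj/funext. Qed.
Let op_scaleDl v : {morph op_scale^~ v : a b / a + b}.
Proof. by move=> a b; apply/val_inj/funext => x /=; rewrite mulrDl chomD. Qed.

HB.instance Definition _ := GRing.Zmodule_isLmodule.Build R (one_param R A)
  op_scaleA op_scale1 op_scaleDr op_scaleDl.
End OneParam.

Section KernelImage.
Variables (A B : topologicalZmodType) (f : chom A B).

Definition chom_ker : {pred A} := fun x => f x == 0.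
Definition chom_im : {pred B} := fun y => `[< exists x, f x = y >].

Let ker_zmod_closed : zmod_closed chom_ker.
Proof.
split=> [|x y]; rewrite !unfold_in ?chom0// chomB => /eqP-> /eqP->.
by rewrite subrr.
Qed.
HB.instance Definition _ := GRing.isZmodClosed.Build A chom_ker ker_zmod_closed.

Let im_zmod_closed : zmod_closed chom_im.
Proof.
split=> [|x y]; first by apply/asboolP; exists 0; rewrite chom0.
move=> /asboolP[x' <-] /asboolP[y' <-]; apply/asboolP.
by exists (x' - y'); rewrite chomB.
Qed.
HB.instance Definition _ := GRing.isZmodClosed.Build B chom_im im_zmod_closed.

Definition induced (q : gquot chom_ker) : B := f (repr q).

Lemma inducedE x : induced (gproj chom_ker x) = f x.
Proof.
apply/eqP; rewrite -subr_eq0 -chomB; apply/(gproj_eq chom_ker).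
exact: reprK.
Qed.

End KernelImage.
Arguments induced {A B} f q.

Definition closed_embedding (X Y : topologicalType) (f : X -> Y) : Prop :=
  [/\ continuous f, injective f & forall C, closed C -> closed (f @` C)].

Definition open_embedding (X Y : topologicalType) (f : X -> Y) : Prop :=
  [/\ continuous f, injective f & forall U, open U -> open (f @` U)].

Definition strict (A B : topologicalZmodType) (f : chom A B) : Prop :=
  closed_embedding (induced f).

Definition topiso (A B : topologicalZmodType) : Prop :=
  exists (f : chom A B) (g : chom B A), cancel f g /\ cancel g f.

Definition integers (R : realType) : {pred R} := fun x => x \is a Num.int.
Arguments integers : clear implicits.

Lemma integers_zmod_closed (R : realType) : zmod_closed (integers R).
Proof. by split=> [|x y]; rewrite !unfold_in; [exact: rpred0|exact: rpredB]. Qed.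
HB.instance Definition _ (R : realType) :=
  GRing.isZmodClosed.Build R (integers R) (@integers_zmod_closed R).

Definition circle (R : realType) : Type := gquot (integers R).
HB.instance Definition _ (R : realType) := TopologicalZmodule.on (circle R).

(* Only the group structure of the dual matters for divisibility, so the      *)
(* compact-open topology is not put on it.                                    *)
Definition dual (R : realType) (A : topologicalZmodType) : Type :=
  chom A (circle R).
HB.instance Definition _ (R : realType) (A : topologicalZmodType) :=
  GRing.Zmodule.on (dual R A).

Definition codivisible (R : realType) (A : topologicalZmodType) : Prop :=
  divisible (dual R A).

(* The categorical cokernel of p : A -> A is the quotient by the closure of   *)
(* the image; a strict map has closed image, so this is A / pA.               *)
Definition finite_ranks (R : realType) (A : topologicalZmodType) : Prop :=
  [/\ finite_dimensional (chom A R^o : lmodType R),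
      finite_dimensional (one_param R A : lmodType R)
    & forall p, prime p ->
        [/\ strict (chom_muln A p),
            finite_set [set x | x \in chom_ker (chom_muln A p)]
          & finite_set [set: gquot (chom_im (chom_muln A p))]]].

Definition FLCAb (R : realType) (A : topologicalZmodType) : Prop :=
  LCA A /\ finite_ranks R A.

Definition topological_torsion (T : topologicalZmodType) : Prop :=
  forall t : T, t *+ k`! @[k --> \oo] --> (0 : T).

Section SubgroupIn.
Variables (A : topologicalZmodType) (S F : zmodClosed A).

Definition subgroup_in : {pred subgroup F} := fun x => sgval x \in S.

Let subgroup_in_zmod_closed : zmod_closed subgroup_in.
Proof.
split=> [|x y xS yS].
  by change (\val (0 : subgroup F) \in S); rewrite raddf0 rpred0.
by change (\val (x - y) \in S); rewrite raddfB rpredB.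
Qed.
HB.instance Definition _ :=
  GRing.isZmodClosed.Build (subgroup F) subgroup_in subgroup_in_zmod_closed.
End SubgroupIn.
Arguments subgroup_in {A} S F x.

Definition canonical_chain (R : realType) (A : topologicalZmodType)
    (S F : zmodClosed A) : Prop :=
  [/\ [/\ closed [set` S], closed [set` F] & [set` S] `<=` [set` F]],
      compact [set` S] /\ connected [set` S],
      discrete (gquot F) /\ torsionfree (gquot F)
    & exists (m : nat) (T : topologicalZmodType),
        [/\ LCA T, topological_torsion T
          & topiso (gquot (subgroup_in S F)) (dsum (gpow R m) T)]].

(* The chain of A is unique, so its first term A_{S^1} is 0 exactly when some *)
(* canonical chain of A starts with S = 0.                                    *)
Definition in_P (R : realType) (A : topologicalZmodType) : Prop :=
  [/\ FLCAb R A, codivisible R A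
    & exists S F : zmodClosed A,
        canonical_chain R S F /\ [set` S] = [set 0]].

Definition Qdisc : Type := rat.
HB.instance Definition _ := GRing.Zmodule.copy Qdisc rat.
HB.instance Definition _ := Topological.copy Qdisc (discrete_topology rat).

Lemma Qdisc_sub_continuous : continuous (fun x : Qdisc * Qdisc => x.1 - x.2).
Proof.
apply: continuous_pair_near => x y W _ Wxy; exists [set x], [set y].
by split=> [||a b /= -> ->//]; exact/principal_filterP.
Qed.
HB.instance Definition _ :=
  PreTopologicalNmodule_isTopologicalZmodule.Build Qdisc Qdisc_sub_continuous.

Record open_subgroup (A : topologicalZmodType) := OpenSubgroup {
  open_subgroup_val :> zmodClosed A;
  open_subgroupP : open [set` open_subgroup_val] }.

Section RestrictedProduct.
Variables (I : Type) (G : I -> topologicalZmodType).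
Variable H : forall i, open_subgroup (G i).

Definition almost_in : {pred gprod G} :=
  fun x => `[< finite_set [set i | x i \notin H i] >].

Record rprod := RProd { rprod_val : gprod G; rprodP : rprod_val \in almost_in }.

HB.instance Definition _ := [isSub for rprod_val].
HB.instance Definition _ := [Choice of rprod by <:].

Let almost_in_zmod_closed : zmod_closed almost_in.
Proof.
split=> [|x y /asboolP fx /asboolP fy]; apply/asboolP.
  apply: (sub_finite_set _ (finite_set0 I)) => i /=.
  by rewrite gprod0 rpred0.
apply: (sub_finite_set _ (_ : finite_set
  ([set i | x i \notin H i] `|` [set i | y i \notin H i]))); last first.
  by rewrite finite_setU.
move=> i /=; rewrite gprodB => xy; apply/or_asboolP/contraT.
by rewrite negb_or !asboolb !negbK => /andP[xH yH]; rewrite rpredB in xy.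
Qed.

HB.instance Definition _ :=
  GRing.isZmodClosed.Build (gprod G) almost_in almost_in_zmod_closed.
HB.instance Definition _ := [SubChoice_isSubZmodule of rprod by <:].

(* A basis of open sets: the products of open sets U i, with U i = H i for    *)
(* all but finitely many i.                                                   *)
Definition rbox (U : forall i, set (G i)) : set rprod :=
  [set x | forall i, U i (rprod_val x i)].

Definition rbox_basic (U : forall i, set (G i)) : Prop :=
  (forall i, open (U i)) /\ finite_set [set i | U i <> [set` H i]].

Definition rprod_open (W : set rprod) : Prop :=
  forall x, W x -> exists U, [/\ rbox_basic U, rbox U x & rbox U `<=` W].

Let rprod_openT : rprod_open setT.
Proof.
move=> x _; exists (fun i => if rprod_val x i \in H i then [set` H i] else setT).
split=> //.
- split=> [i|]; first by case: ifP => _; [exact: open_subgroupP|exact: openT].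
  apply: sub_finite_set (asboolW (rprodP x)) => i /=.
  by case: ifP.
- by move=> i; case: ifP.
Qed.

Let rprod_openI : setI_closed rprod_open.
Proof.
move=> V W oV oW x [/oV[U [[oU fU] Ux UV]] /oW[U' [[oU' fU'] U'x U'W]]].
exists (fun i => U i `&` U' i); split.
- split=> [i|]; first exact: openI.
  apply: (sub_finite_set _ (_ : finite_set ([set i | U i <> [set` H i]] `|`
    [set i | U' i <> [set` H i]]))); last by rewrite finite_setU.
  move=> i /= UU'; apply: contrapT => /not_orP[/contrapT E /contrapT E'].
  by apply: UU'; rewrite E E' setIid.
- by move=> i; split; [exact: Ux|exact: U'x].
- by move=> y UU'y; split; [apply: UV|apply: U'W] => i; case: (UU'y i).
Qed.

Let rprod_open_bigU (J : Type) (f : J -> set rprod) :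
  (forall j, rprod_open (f j)) -> rprod_open (\bigcup_j f j).
Proof.
move=> of_ x [j _ /of_[U [bU Ux Uf]]]; exists U; split=> // y /Uf fy.
by exists j.
Qed.

HB.instance Definition _ :=
  isOpenTopological.Build rprod rprod_openT rprod_openI rprod_open_bigU.

Lemma rprod_openE (W : set rprod) : open W = rprod_open W. Proof. by []. Qed.

Lemma rbox_open U : rbox_basic U -> open (rbox U).
Proof. by move=> bU; rewrite rprod_openE => x Ux; exists U; split. Qed.

Lemma rprod_sub_continuous : continuous (fun x : rprod * rprod => x.1 - x.2).
Proof.
apply: continuous_pair_near => x y W oW Wxy.
move: oW; rewrite rprod_openE => /(_ _ Wxy)[U [[oU fU] Uxy UW]].
pose good i := [/\ U i = [set` H i], rprod_val x i \in H i
  & rprod_val y i \in H i].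
have PQ_ex : forall i, exists PQ : set (G i) * set (G i),
  [/\ [/\ open PQ.1, PQ.1 (rprod_val x i), open PQ.2 & PQ.2 (rprod_val y i)],
    (forall a b, PQ.1 a -> PQ.2 b -> U i (a - b)) &
    good i -> PQ.1 = [set` H i] /\ PQ.2 = [set` H i]].
  move=> i; have [gi|ngi] := pselect (good i).
    case: gi => UH xH yH; exists ([set` H i], [set` H i]) => /=; split=> //.
      by split=> //; exact: open_subgroupP.
    by rewrite UH => a b /= aH bH; exact: rpredB.
  have : nbhs (rprod_val x i - rprod_val y i) (U i).
    by apply: open_nbhs_nbhs; split; [exact: oU|exact: Uxy].
  move=> /sub_near[P [Q [xP yQ PQU]]].
  exists (interior P, interior Q) => /=; split=> //.
    by split=> //; exact: open_interior.
  by move=> a b /interior_subset Pa /interior_subset Qb; exact: PQU.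
pose PQ i := sval (cid (PQ_ex i)).
have PQP i : [/\ [/\ open (PQ i).1, (PQ i).1 (rprod_val x i), open (PQ i).2
      & (PQ i).2 (rprod_val y i)],
    (forall a b, (PQ i).1 a -> (PQ i).2 b -> U i (a - b)) &
    good i -> (PQ i).1 = [set` H i] /\ (PQ i).2 = [set` H i]].
  exact: svalP (cid (PQ_ex i)).
have fgood : finite_set [set i | ~ good i].
  apply: (sub_finite_set _ (_ : finite_set ([set i | U i <> [set` H i]] `|`
    ([set i | rprod_val x i \notin H i] `|`
     [set i | rprod_val y i \notin H i])))).
    move=> i /= ngi; apply: contrapT => /not_orP[/contrapT UH].
    move=> /not_orP[/negP/negPn xH /negP/negPn yH].
    by apply: ngi.
  rewrite !finite_setU; split=> //.
  by split; [exact: asboolW (rprodP x)|exact: asboolW (rprodP y)].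
exists (rbox (fun i => (PQ i).1)), (rbox (fun i => (PQ i).2)); split.
- apply: open_nbhs_nbhs; split; last by move=> i; have [[]] := PQP i.
  apply: rbox_open; split; first by move=> i; have [[]] := PQP i.
  apply: sub_finite_set fgood => i /= PH gi.
  by have [_ _ /(_ gi)[]] := PQP i.
- apply: open_nbhs_nbhs; split; last by move=> i; have [[]] := PQP i.
  apply: rbox_open; split; first by move=> i; have [[]] := PQP i.
  apply: sub_finite_set fgood => i /= PH gi.
  by have [_ _ /(_ gi)[]] := PQP i.
- move=> a b Pa Qb; apply: UW => i /=.
  by have [_ + _] := PQP i; apply; [exact: Pa|exact: Qb].
Qed.

HB.instance Definition _ :=
  PreTopologicalNmodule_isTopologicalZmodule.Build rprod rprod_sub_continuous.

End RestrictedProduct.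

Definition padic_abs (p : nat) (x : rat) : rat :=
  if x == 0 then 0
  else p%:R ^ ((logn p `|denq x|)%:Z - (logn p `|numq x|)%:Z).

Lemma padic_abs0 p : padic_abs p 0 = 0.
Proof. by rewrite /padic_abs eqxx. Qed.

Lemma padic_absN p x : padic_abs p (- x) = padic_abs p x.
Proof. by rewrite /padic_abs oppr_eq0 numqN denqN abszN. Qed.

Lemma padic_abs_ge0 p x : 0 <= padic_abs p x.
Proof. by rewrite /padic_abs; case: ifP => // _; exact: exprz_ge0. Qed.

Lemma padic_abs_frac p (a b : int) : a != 0 -> b != 0 ->
  padic_abs p (a%:~R / b%:~R) = p%:R ^ ((logn p `|b|)%:Z - (logn p `|a|)%:Z).
Proof.
move=> a0 b0; rewrite /padic_abs.
set x := (_ / _); have x0 : x != 0 by rewrite mulf_neq0 ?invr_eq0 ?intr_eq0.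
rewrite (negbTE x0); congr (_ ^ _).
have E : numq x * b = a * denq x.
  apply: (@intr_inj rat); rewrite !rmorphM /= numqE /x mulrAC.
  by rewrite divfK ?intr_eq0.
have n0 : numq x != 0 by rewrite numq_eq0.
have := congr1 (fun z : int => logn p `|z|) E => /=.
rewrite !abszM !lognM ?absz_gt0 ?denq_eq0//.
by lia.
Qed.

Lemma logn_sub_ge p (a b : int) : prime p -> a != 0 -> b != 0 -> a - b != 0 ->
  (minn (logn p `|a|) (logn p `|b|) <= logn p `|a - b|)%N.
Proof.
move=> pp a0 b0 ab0; rewrite -pfactor_dvdn ?absz_gt0//.
have da : ((p ^ minn (logn p `|a|) (logn p `|b|))%N%:Z %| a)%Z.
  by rewrite dvdzE pfactor_dvdn ?absz_gt0// geq_minl.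
have db : ((p ^ minn (logn p `|a|) (logn p `|b|))%N%:Z %| b)%Z.
  by rewrite dvdzE pfactor_dvdn ?absz_gt0// geq_minr.
by have := rpredB da db; rewrite dvdzE.
Qed.

Lemma padic_absB_le p x y (e : rat) : prime p ->
  padic_abs p x <= e -> padic_abs p y <= e -> padic_abs p (x - y) <= e.
Proof.
move=> pp xe ye.
have [->|x0] := eqVneq x 0; first by rewrite sub0r padic_absN.
have [->|y0] := eqVneq y 0; first by rewrite subr0.
have [->|xy0] := eqVneq (x - y) 0.
  by rewrite padic_abs0 (le_trans _ xe) ?padic_abs_ge0.
have p1 : 1 <= p%:R :> rat by rewrite ler1n prime_gt0.
move: xe ye; rewrite -[in padic_abs p x](divq_num_den x).
rewrite -[in padic_abs p y](divq_num_den y).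
have E : x - y = (numq x * denq y - numq y * denq x)%:~R
                 / (denq x * denq y)%:~R.
  rewrite -[in LHS](divq_num_den x) -[in LHS](divq_num_den y).
  rewrite rmorphB !rmorphM /=; field.
  by rewrite !intr_eq0 !denq_eq0.
have n0 : numq x * denq y - numq y * denq x != 0.
  by apply: contra xy0; rewrite E => /eqP->; rewrite mul0r.
rewrite E !padic_abs_frac ?numq_eq0 ?denq_eq0 ?mulf_neq0 ?denq_eq0//.
move=> xe ye; have := logn_sub_ge pp _ _ n0.
rewrite !mulf_neq0 ?numq_eq0 ?denq_eq0// => /(_ isT isT).
rewrite !abszM !lognM ?absz_gt0 ?numq_eq0 ?denq_eq0// => nle.
set dx := logn p `|denq x| in xe nle *; set dy := logn p `|denq y| in ye nle *.
set nx := logn p `|numq x| in xe nle; set ny := logn p `|numq y| in ye nle.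
move: (logn p `|_ - _|) nle => L nle; clearbody dx dy nx ny.
have [le|le] := leqP (dx + ny) (dy + nx).
  by apply: le_trans ye; apply: ler_weXz2l => //; lia.
by apply: le_trans xe; apply: ler_weXz2l => //; lia.
Qed.

Lemma padic_absB_lt p x y (e : rat) : prime p ->
  padic_abs p x < e -> padic_abs p y < e -> padic_abs p (x - y) < e.
Proof.
move=> pp xe ye.
have [xy|/ltW yx] := leP (padic_abs p x) (padic_abs p y).
  exact: le_lt_trans (padic_absB_le pp xy (lexx _)) ye.
exact: le_lt_trans (padic_absB_le pp (lexx _) yx) xe.
Qed.

Definition prime_nat : Type := {p : nat | prime p}.

Section Padic.
Variable p : prime_nat.
Local Notation abs := (padic_abs (sval p)).

Definition padic_cauchy : {pred nat -> rat} := fun u =>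
  `[< forall e : rat, 0 < e -> exists N, forall m n,
        (N <= m)%N -> (N <= n)%N -> abs (u m - u n) < e >].

Record cauchy_seq := CauchySeq {
  cauchy_val :> nat -> rat; cauchy_valP : cauchy_val \in padic_cauchy }.

HB.instance Definition _ := [isSub for cauchy_val].
HB.instance Definition _ := [Choice of cauchy_seq by <:].

Let padic_cauchy_zmod_closed : zmod_closed padic_cauchy.
Proof.
split=> [|u v /asboolP cu /asboolP cv]; apply/asboolP => e e0.
  by exists 0 => m n _ _; rewrite subrr padic_abs0.
have [N Nu] := cu _ e0; have [M Mv] := cv _ e0.
exists (maxn N M) => m n; rewrite !geq_max => /andP[Nm Mm] /andP[Nn Mn].
rewrite (_ : _ - _ = (u m - u n) - (v m - v n)); last first.
  have E k : (u - v) k = u k - v k by [].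
  by rewrite !E; ring.
by apply: padic_absB_lt; [exact: valP|exact: Nu|exact: Mv].
Qed.

HB.instance Definition _ :=
  GRing.isZmodClosed.Build (nat -> rat) padic_cauchy padic_cauchy_zmod_closed.
HB.instance Definition _ := [SubChoice_isSubZmodule of cauchy_seq by <:].

Lemma cauchy_seqB (u v : cauchy_seq) n : (u - v) n = u n - v n.
Proof. by []. Qed.

Lemma cauchy_seq0 n : (0 : cauchy_seq) n = 0.
Proof. by []. Qed.

(* The open ball of radius e for the seminorm u |-> lim_n |u n|_p.            *)
Definition padic_ball (u : cauchy_seq) (e : rat) : set cauchy_seq :=
  [set v | \forall n \near \oo, abs (u n - v n) < e].

Lemma padic_ball_refl u e : 0 < e -> padic_ball u e u.
Proof. by move=> e0; near=> n; rewrite subrr padic_abs0. Unshelve. all: by end_near. Qed.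

Lemma padic_ball_sub u v u' v' e : padic_ball u e u' -> padic_ball v e v' ->
  padic_ball (u - v) e (u' - v').
Proof.
move=> uu vv; near=> n; rewrite !cauchy_seqB.
rewrite (_ : _ - _ = (u n - u' n) - (v n - v' n)); last by ring.
by apply: padic_absB_lt; [exact: valP|near: n|near: n].
Unshelve. all: by end_near. Qed.

Lemma padic_ball_trans u v w e :
  padic_ball u e v -> padic_ball v e w -> padic_ball u e w.
Proof.
move=> uv vw; near=> n.
rewrite (_ : _ - _ = (u n - v n) - (w n - v n)); last by ring.
apply: padic_absB_lt; [exact: valP|near: n|]; first exact: uv.
by rewrite -padic_absN opprB; near: n.
Unshelve. all: by end_near. Qed.

Definition cauchy_seq_open (W : set cauchy_seq) : Prop :=
  forall u, W u -> exists2 e, 0 < e & padic_ball u e `<=` W.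

Let cauchy_seq_openT : cauchy_seq_open setT.
Proof. by move=> u _; exists 1. Qed.

Let cauchy_seq_openI : setI_closed cauchy_seq_open.
Proof.
move=> V W oV oW u [/oV[e e0 eV] /oW[d d0 dW]].
exists (Num.min e d); first by rewrite lt_min e0 d0.
move=> v uv; split; [apply: eV|apply: dW]; apply: filterS uv => n;
  by rewrite lt_min => /andP[].
Qed.

Let cauchy_seq_open_bigU (J : Type) (f : J -> set cauchy_seq) :
  (forall j, cauchy_seq_open (f j)) -> cauchy_seq_open (\bigcup_j f j).
Proof.
move=> of_ u [j _ /of_[e e0 ef]]; exists e => // v /ef fv.
by exists j.
Qed.

HB.instance Definition _ := isOpenTopological.Build cauchy_seq
  cauchy_seq_openT cauchy_seq_openI cauchy_seq_open_bigU.

Lemma cauchy_seq_openE (W : set cauchy_seq) : open W = cauchy_seq_open W.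
Proof. by []. Qed.

Lemma padic_ball_near u e : 0 < e -> nbhs u (padic_ball u e).
Proof.
move=> e0; apply: open_nbhs_nbhs; split; last exact: padic_ball_refl.
rewrite cauchy_seq_openE => v uv; exists e => // w; exact: padic_ball_trans.
Qed.

Lemma cauchy_seq_sub_continuous :
  continuous (fun x : cauchy_seq * cauchy_seq => x.1 - x.2).
Proof.
apply: continuous_pair_near => u v W + Wuv.
rewrite cauchy_seq_openE => /(_ _ Wuv)[e e0 eW].
exists (padic_ball u e), (padic_ball v e); split; try exact: padic_ball_near.
by move=> a b ua vb; apply: eW; exact: padic_ball_sub.
Qed.

HB.instance Definition _ :=
  PreTopologicalNmodule_isTopologicalZmodule.Build cauchy_seq
    cauchy_seq_sub_continuous.

Definition padic_null : {pred cauchy_seq} := fun u =>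
  `[< forall e : rat, 0 < e -> \forall n \near \oo, abs (u n) < e >].

Let padic_null_zmod_closed : zmod_closed padic_null.
Proof.
split=> [|u v /asboolP u0 /asboolP v0]; apply/asboolP => e e0.
  by near=> n; rewrite cauchy_seq0 padic_abs0.
near=> n; rewrite cauchy_seqB.
by apply: padic_absB_lt; [exact: valP|near: n; exact: u0|near: n; exact: v0].
Unshelve. all: by end_near. Qed.

HB.instance Definition _ :=
  GRing.isZmodClosed.Build cauchy_seq padic_null padic_null_zmod_closed.

(* The additive group of Q_p, as the completion of Q for |.|_p.               *)
Definition Qp : Type := gquot padic_null.
HB.instance Definition _ := TopologicalZmodule.on Qp.

(* Z_p is the closed unit ball.                                               *)
Definition Zp_pred : {pred Qp} := fun x =>
  `[< exists2 u : cauchy_seq, gproj padic_null u = x &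
        \forall n \near \oo, abs (u n) <= 1 >].

Let Zp_zmod_closed : zmod_closed Zp_pred.
Proof.
split=> [|x y /asboolP[u <- u1] /asboolP[v <- v1]]; apply/asboolP.
  exists 0; first exact: gproj0.
  by near=> n; rewrite cauchy_seq0 padic_abs0.
exists (u - v); first exact: gprojB.
near=> n; rewrite cauchy_seqB.
by apply: padic_absB_le; [exact: valP|near: n|near: n].
Unshelve. all: by end_near. Qed.

HB.instance Definition _ := GRing.isZmodClosed.Build Qp Zp_pred Zp_zmod_closed.

Lemma Zp_open : open [set` Zp_pred].
Proof.
rewrite openE => x /asboolP[u <- u1]; apply/gproj_near.
apply: filterS (padic_ball_near u ltr01) => v uv.
apply/asboolP; exists v => //; near=> n.
rewrite (_ : v n = u n - (u n - v n)); last by ring.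
apply: padic_absB_le; [exact: valP|by near: n|].
by apply: ltW; near: n; exact: uv.
Unshelve. all: by end_near. Qed.

Definition Zp_pow_pred (r : nat) : {pred gpow Qp r} :=
  fun x => `[< forall i, x i \in Zp_pred >].

Section Power.
Variable r : nat.

Let Zp_pow_zmod_closed : zmod_closed (@Zp_pow_pred r).
Proof.
split=> [|x y /asboolP xZ /asboolP yZ]; apply/asboolP => i.
  exact: (rpred0 Zp_pred).
exact: (rpredB (xZ i) (yZ i)).
Qed.

HB.instance Definition _ :=
  GRing.isZmodClosed.Build (gpow Qp r) (@Zp_pow_pred r) Zp_pow_zmod_closed.

Lemma Zp_pow_open : open [set` @Zp_pow_pred r].
Proof.
rewrite openE => x /asboolP xZ.
have : \forall y \near x, forall i, y i \in Zp_pred.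
  apply: (@filter_forall _ _
    (fun i => [set y : gpow Qp r | y i \in Zp_pred]) (nbhs x) _) => i.
  apply: (@gprod_proj_near _ (fun=> Qp) x i [set` Zp_pred]).
  by apply: open_nbhs_nbhs; split; [exact: Zp_open|exact: xZ].
by apply: filterS => y yZ; apply/asboolP.
Qed.

Definition Zp_pow : open_subgroup (gpow Qp r) := OpenSubgroup Zp_pow_open.

End Power.
End Padic.

Definition QRQp (R : realType) (r s : nat) (rp : prime_nat -> nat) : Type :=
  dsum (gpow Qdisc r)
       (dsum (gpow R s) (rprod (fun p : prime_nat => Zp_pow p (rp p)))).
HB.instance Definition _ (R : realType) r s rp :=
  TopologicalZmodule.on (QRQp R r s rp).

Definition divisible_extension (A D : topologicalZmodType) (f : chom A D) :
    Prop :=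
  [/\ LCA D, divisible D, open_embedding f & torsion (gquot (chom_im f))].

(* Main.v *)
Require Import Defs.
From HB Require Import structures.
From mathcomp Require Import all_boot all_order all_algebra zify ring lra.
From mathcomp Require Import all_classical all_reals topology normedtype.

(** Every abelian group A sits in a divisible group, namely a power of the
    circle, because the circle is divisible and so has enough characters to
    separate points.  Dividing this group by a subgroup maximal among those
    that meet A trivially gives a divisible group D in which A is essential:
    every non-zero element of D has a non-zero multiple in A
    ([divisible_hull]).  Hence D/A is torsion, and declaring A to be open turns
    D into a locally compact group.  This is the extension of (i).

    The same D works for (ii).  A homomorphism from A to the divisible
    torsion-free group of real numbers extends uniquely to D; a one-parameter
    subgroup of D stays in the open subgroup A; D = pD; and D has no p-torsion
    outside A because A is essential.  Strictness of p on D amounts to p being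
    an open map, which passes between A and D because A is open in D; on A it
    holds because pA is closed of finite index ([extension_finite_ranks]).

    For (iii), the canonical chain of A in P gives an open subgroup F of A
    isomorphic to R^m + T, where T is topologically torsion and A/F is discrete
    and torsion-free.  All multiples of an element of T stay in a compact set,
    so T has a compact open subgroup U ([compact_open_subgroup]), and a Baire
    argument makes the convergence of k! u to 0 uniform on U
    ([uniform_torsion]).  Multiplication by n is open on T, so the subgroups n U
    form a basis of neighbourhoods of 0.  If a is a non-zero torsion element of
    A, some open subgroup R^m + n U misses it, and a character of the discrete
    quotient that is non-trivial at a cannot be divisible: codivisible groups
    of this kind are torsion-free ([codivisible_torsionfree]).

    Now U is compact, torsion-free and its topology is given by the subgroups
    n U.  For a prime p, lifting a basis of U/pU over the field with p elements
    to x_1, ..., x_r gives a basis of U/p^k U over Z/p^k for all k, so that the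
    coordinates of u modulo p^k converge to r elements of Z_p.  Together they
    form an isomorphism from U to the product of the groups Z_p^(r_p)
    ([profinite_coordinates]); surjectivity is the Chinese remainder theorem
    and compactness.  The isomorphism from R^m + U to the product of R^m and
    this group extends to a homomorphism from A to the product of R^m and the
    restricted product, because the latter are divisible.  The rank of A/F is at
    most the dimension of Hom(A, R), which yields a map from A to Q^r with
    kernel F and torsion cokernel ([rank_coordinates]).
    These two maps form the embedding; its target is locally compact because it
    contains the image of A as an open subgroup ([LCA_open_embedding]). *)

Set Implicit Arguments.
Unset Strict Implicit.
Unset Printing Implicit Defensive.

Import Order.TTheory GRing.Theory Num.Theory.
Import numFieldNormedType.Exports.

Local Open Scope classical_set_scope.
Local Open Scope ring_scope.

(** * Subgroups, homomorphisms and divisible groups *)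

(** Subgroups as classical sets: most of those below are given by existential
    conditions, for which [zmodClosed] would require a boolean predicate with
    a registered instance. *)
Definition subgrp (G : zmodType) (S : set G) : Prop :=
  S 0 /\ forall x y, S x -> S y -> S (x - y).

Section Subgrp.
Variables (G : zmodType) (S : set G).
Hypothesis subS : subgrp S.

Lemma subgrp0 : S 0. Proof. by case: subS. Qed.

Lemma subgrpB x y : S x -> S y -> S (x - y).
Proof. by case: subS => _; exact. Qed.

Lemma subgrpN x : S x -> S (- x).
Proof. by move=> Sx; rewrite -sub0r; apply: subgrpB => //; exact: subgrp0. Qed.

Lemma subgrpD x y : S x -> S y -> S (x + y).
Proof. by move=> Sx Sy; rewrite -[y]opprK; apply/subgrpB/subgrpN. Qed.

Lemma subgrpMn x n : S x -> S (x *+ n).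
Proof.
move=> Sx; elim: n => [|n IH]; first exact: subgrp0.
by rewrite mulrS; exact: subgrpD.
Qed.

Lemma subgrpMz x k : S x -> S (x *~ k).
Proof.
by move=> Sx; case: k => n; [|rewrite NegzE mulrNz; apply: subgrpN];
  exact: subgrpMn.
Qed.

Lemma subgrp_sum (I : Type) (r : seq I) (F : I -> G) :
  (forall i, S (F i)) -> S (\sum_(i <- r) F i).
Proof.
by move=> SF; elim/big_ind : _ => //; [exact: subgrp0|exact: subgrpD].
Qed.

(** The proof is an argument so that the closure instance can be found from
    the predicate alone; this gives access to quotients by a subgroup given
    as a set. *)
Definition subgrp_pred of subgrp S : {pred G} := fun x => `[< S x >].

Lemma subgrp_predE x : (x \in subgrp_pred subS) = `[< S x >].
Proof. by []. Qed.

Lemma subgrp_predP x : (x \in subgrp_pred subS) <-> S x.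
Proof. by rewrite subgrp_predE; split => /asboolP. Qed.

Lemma subgrp_pred_closed : zmod_closed (subgrp_pred subS).
Proof.
split=> [|x y /subgrp_predP Sx /subgrp_predP Sy]; apply/subgrp_predP.
  exact: subgrp0.
exact: subgrpB.
Qed.
HB.instance Definition _ :=
  GRing.isZmodClosed.Build G (subgrp_pred subS) subgrp_pred_closed.

End Subgrp.

Lemma zmodClosed_subgrp (G : zmodType) (H : zmodClosed G) : subgrp [set` H].
Proof. by split=> [|x y] /=; [exact: rpred0|exact: rpredB]. Qed.

Lemma zmod_morphMz (G H : zmodType) (f : G -> H) : zmod_morphism f ->
  forall x k, f (x *~ k) = f x *~ k.
Proof.
move=> fm x k.
pose F := GRing.isZmodMorphism.Build G H f fm.
pose f' : {additive G -> H} := HB.pack f F.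
exact: (raddfMz f').
Qed.

Lemma zmod_morph0 (G H : zmodType) (f : G -> H) : zmod_morphism f -> f 0 = 0.
Proof. by move=> fm; rewrite -(subrr 0) fm subrr. Qed.

Lemma zmod_morphMn (G H : zmodType) (f : G -> H) : zmod_morphism f ->
  forall x n, f (x *+ n) = f x *+ n.
Proof. by move=> fm x n; exact: (zmod_morphMz fm x n). Qed.

Lemma zmod_morphN (G H : zmodType) (f : G -> H) : zmod_morphism f ->
  {morph f : x / - x}.
Proof. by move=> fm x; rewrite -sub0r fm (zmod_morph0 fm) sub0r. Qed.

Lemma zmod_morphD (G H : zmodType) (f : G -> H) : zmod_morphism f ->
  {morph f : x y / x + y}.
Proof. by move=> fm x y; rewrite -{1}[y]opprK fm (zmod_morphN fm) opprK. Qed.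

Lemma hom_inj (A B : zmodType) (f : A -> B) : zmod_morphism f ->
  (forall x, f x = 0 -> x = 0) -> injective f.
Proof.
move=> fm f0 x y /eqP; rewrite -subr_eq0 -fm => /eqP/f0/eqP.
by rewrite subr_eq0 => /eqP.
Qed.

Section DivisibleExtension.
Variables (G D : zmodType).
Hypothesis divD : divisible D.

(** The graphs of homomorphisms from subgroups of [G] to [D]. Partial
    homomorphisms are handled through their graphs: extension becomes
    inclusion and the union of a chain needs no gluing. *)
Definition functional (Gam : set (G * D)) : Prop :=
  subgrp Gam /\ forall d, Gam (0, d) -> d = 0.

Let dom (Gam : set (G * D)) (g : G) : Prop := exists d, Gam (g, d).

(** Only the least positive multiple [n] of [g] in the domain constrains the
    value of the extension at [g], and divisibility of [D] allows to divide
    the image of [g *+ n] by [n]; if no multiple of [g] lies in the domain,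
    any value will do. *)
Let adjoin (Gam : set (G * D)) (g : G) : functional Gam ->
  exists Gam', [/\ functional Gam', Gam `<=` Gam' & dom Gam' g].
Proof.
move=> [sG fG].
have [c cP] : exists c : D, forall k : int, dom Gam (g *~ k) ->
    Gam (g *~ k, c *~ k).
  have [[n0 /andP[n0_gt0 /asboolP n0dom]]|no] :=
    pselect (exists n, (0 < n)%N && `[< dom Gam (g *+ n) >]); last first.
    exists 0 => k dk; rewrite mul0rz.
    suff -> : k = 0 by rewrite mulr0z; exact: (subgrp0 sG).
    apply: contrapT => /eqP k0; apply: no; exists `|k|%N.
    rewrite absz_gt0 k0 /=; apply/asboolP; case: dk => d dk.
    case: (intP k) k0 dk => // n _ dk; first by exists d.
    exists (- d); have := subgrpN sG dk.
    by rewrite abszN/= -[- (_, _)]/(- _, - _) mulrNz opprK.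
  have exn : exists n, (0 < n)%N && `[< dom Gam (g *+ n) >].
    by exists n0; rewrite n0_gt0; apply/asboolP.
  case: (ex_minnP exn) => n /andP[n_gt0 /asboolP[d nd]] nmin.
  have [c cd] := divD n_gt0 d.
  have H m : Gam (g *~ (m * n%:Z), c *~ (m * n%:Z)).
    rewrite mulrC !mulrzA -!pmulrn cd.
    have := subgrpMz sG m nd.
    suff -> : (g *+ n, d) *~ m = (g *+ n *~ m, d *~ m) by [].
    have E k : (g *+ n, d) *+ k = (g *+ n *+ k, d *+ k).
      by elim: k => [//|k IH]; rewrite !mulrS IH.
    by case: m => k; rewrite ?NegzE ?mulrNz -?pmulrn E.
  exists c => k [e ke].
  have kE := divz_eq k n.
  suff r0 : (k %% n)%Z = 0 by rewrite kE r0 addr0; exact: H.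
  apply: contrapT => /eqP r0.
  have r_ge0 : 0 <= (k %% n)%Z by rewrite modz_ge0// -lt0n.
  have : (n <= `|(k %% n)%Z|)%N.
    apply: nmin; rewrite absz_gt0 r0 /=; apply/asboolP.
    exists (e - c *~ ((k %/ n)%Z * n)).
    have := subgrpB sG ke (H (k %/ n)%Z).
    rewrite -[(_, _) - _]/(_ - _, _ - _) -mulrzBr {1}kE addrC addKr.
    by case: (k %% n)%Z r_ge0.
  have : (k %% n)%Z < n%:Z by apply: ltz_pmod.
  by lia.
exists [set x | exists2 y, Gam y & exists k : int, x = y + (g *~ k, c *~ k)].
split.
- split.
    split.
      by exists 0; [exact: (subgrp0 sG)|exists 0; rewrite !mulr0z addr0].
    move=> _ _ [y Gy [k ->]] [z Gz [l ->]].
    exists (y - z); first exact: subgrpB.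
    exists (k - l); rewrite !mulrzBr.
    by rewrite -[(_ - _, _ - _)]/((_, _) - (_, _)) opprD addrACA.
  move=> d [[y1 y2] Gy [k]] [/esym y1E ->].
  have y1E' : y1 = - (g *~ k) by apply/eqP; rewrite -addr_eq0 y1E.
  have /cP Gk : dom Gam (g *~ k).
    exists (- y2); have := subgrpN sG Gy.
    by rewrite y1E' -[- (_, _)]/(- _, - _) opprK.
  apply: fG; have := subgrpD sG Gy Gk.
  by rewrite -[(_, _) + _]/(_ + _, _ + _) y1E.
- by move=> x Gx; exists x => //; exists 0; rewrite !mulr0z addr0.
- by exists c; exists 0; [exact: (subgrp0 sG)|exists 1; rewrite !mulr1z add0r].
Qed.

(** Injectivity of divisible groups (Baer): the graph of a maximal extension
    has full domain, since otherwise one more element could be adjoined. *)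
Lemma divisible_extend (Gam : set (G * D)) : functional Gam ->
  exists2 h : G -> D, zmod_morphism h & forall g d, Gam (g, d) -> h g = d.
Proof.
move=> fG.
(* Adding [Gam] to the members of the chain takes care of the empty chain. *)
have [C|E [PE maxE]] := @Zorn_bigcup (G * D)%type
    (fun X => functional (Gam `|` X)).
  move=> CP tot; split.
    split; first by left; exact: (subgrp0 fG.1).
    move=> x y [Gx|[X CX Xx]] [Gy|[Y CY Yy]].
    - by left; exact: (subgrpB fG.1).
    - by have [h|h] := subgrpB (CP _ CY).1 (or_introl Gx) (or_intror Yy);
        [left|right; exists Y].
    - by have [h|h] := subgrpB (CP _ CX).1 (or_intror Xx) (or_introl Gy);
        [left|right; exists X].
    - have [XY|YX] := tot _ _ CX CY.
        have [h|h] := subgrpB (CP _ CY).1 (or_intror (XY _ Xx)) (or_intror Yy).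
          by left.
        by right; exists Y.
      have [h|h] := subgrpB (CP _ CX).1 (or_intror Xx) (or_intror (YX _ Yy)).
        by left.
      by right; exists X.
  move=> d [Gd|[X CX Xd]]; first exact: fG.2.
  by apply: (CP _ CX).2; right.
pose M := Gam `|` E.
have domM g : dom M g.
  have [M' [fM' MM' domM']] := adjoin g PE.
  apply: contrapT => ndom.
  have GM' : Gam `|` M' = M' by apply/setUidPr => x Gx; apply: MM'; left.
  apply: (maxE M'); last by rewrite GM'.
  split; last by move=> M'E; case: domM' => d /M'E Ed; apply: ndom; exists d;
    right.
  by move=> x Ex; apply: MM'; right.
have [h hM] : {h : G -> D & forall g, M (g, h g)}.
  by exists (fun g => sval (cid (domM g))) => g; exact: svalP (cid (domM g)).
have uniq g d : M (g, d) -> h g = d.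
  move=> Md; apply/eqP; rewrite -subr_eq0; apply/eqP/PE.2.
  by have := subgrpB PE.1 (hM g) Md; rewrite -[(_, _) - _]/(_ - _, _ - _) subrr.
exists h; last by move=> g d Gd; apply: uniq; left.
by move=> x y; apply: uniq; exact: (subgrpB PE.1 (hM x) (hM y)).
Qed.

End DivisibleExtension.

(** * Characters of abstract abelian groups *)

Lemma gproj_morphism (A : topologicalZmodType) (H : zmodClosed A) :
  zmod_morphism (gproj H).
Proof. exact: gprojB. Qed.

Lemma gprojMn (A : topologicalZmodType) (H : zmodClosed A) x n :
  gproj H (x *+ n) = gproj H x *+ n.
Proof. exact: (zmod_morphMn (@gproj_morphism A H)). Qed.

Lemma gprojMz (A : topologicalZmodType) (H : zmodClosed A) x k :
  gproj H (x *~ k) = gproj H x *~ k.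
Proof. exact: (zmod_morphMz (@gproj_morphism A H)). Qed.

Lemma gproj_eq0 (A : topologicalZmodType) (H : zmodClosed A) x :
  gproj H x = 0 <-> x \in H.
Proof. by rewrite -(gproj0 H) gproj_eq subr0. Qed.

Lemma gquot_divisible (A : topologicalZmodType) (H : zmodClosed A) :
  divisible A -> divisible (gquot H).
Proof.
move=> divA n n0 q; have [x <-] := gproj_surj q.
by have [y <-] := divA n n0 x; exists (gproj H y); rewrite gprojMn.
Qed.

Lemma divisible_field (R : numFieldType) : divisible R.
Proof.
move=> n n0 x; exists (x / n%:R).
by rewrite -[LHS]mulr_natr mulfVK// pnatr_eq0 -lt0n.
Qed.

Lemma circle_divisible (R : realType) : divisible (circle R).
Proof. exact/gquot_divisible/divisible_field. Qed.

Lemma cyclic_functional (G D : zmodType) (x : G) (c : D) :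
  (forall k : int, x *~ k = 0 -> c *~ k = 0) ->
  functional [set y | exists k : int, y = (x *~ k, c *~ k)].
Proof.
move=> xc; split; last by move=> d [k [/esym/xc + ->]].
split; first by exists 0; rewrite !mulr0z.
by move=> _ _ [k ->] [l ->]; exists (k - l); rewrite !mulrzBr.
Qed.

(** The cyclic group generated by [x] has a character that does not vanish at
    [x], with value 1/n if [x] has finite order n and 1/2 otherwise; it
    extends because the circle is divisible. *)
Lemma character_separates (R : realType) (G : zmodType) (x : G) : x != 0 ->
  exists2 h : G -> circle R, zmod_morphism h & h x != 0.
Proof.
move=> x0.
suff [c c0 cP] : exists2 c : circle R, c != 0 &
    forall k : int, x *~ k = 0 -> c *~ k = 0.
  have [h hm hc] := divisible_extend (@circle_divisible R) (cyclic_functional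
    cP).
  by exists h => //; rewrite (hc x c)//; exists 1; rewrite !mulr1z.
have [fin|inf] := pselect (exists n, (0 < n)%N && (x *+ n == 0)); last first.
  exists (gproj (integers R) 2^-1).
    apply/eqP => /gproj_eq0; rewrite unfold_in => /intrP[m mE].
    have : 1 = (m * 2)%:~R :> R
      by rewrite rmorphM /= -mE mulVf ?pnatr_eq0 -?lt0n.
    by move=> /(@intr_inj R 1); lia.
  move=> k xk; suff -> : k = 0 by rewrite mulr0z.
  apply: contrapT => /eqP k0; apply: inf; exists `|k|%N; rewrite absz_gt0 k0 /=.
  by case: k {k0} xk => n; rewrite ?NegzE -?pmulrn ?mulrNz ?abszN; [move=>
    ->|move/eqP; rewrite oppr_eq0].
case: (ex_minnP fin) => n /andP[n_gt0 /eqP xn0] nmin.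
have n1 : (1 < n)%N.
  rewrite ltn_neqAle n_gt0 andbT; apply: contra x0 => /eqP nE.
  by rewrite -xn0 -nE mulr1n.
have nR : n%:R != 0 :> R by rewrite pnatr_eq0 -lt0n.
exists (gproj (integers R) n%:R^-1).
  apply/eqP => /gproj_eq0; rewrite unfold_in => /intrP[m mE].
  have : 1 = (m * n%:Z)%:~R :> R
    by rewrite rmorphM /= -mE mulVf ?pnatr_eq0 -?lt0n.
  move=> /(@intr_inj R 1) /(congr1 absz); rewrite abszM absz_nat => /esym.
  by move/eqP; rewrite muln_eq1 => /andP[_ /eqP nE]; rewrite nE in n1.
move=> k xk; rewrite -gprojMz; apply/gproj_eq0; rewrite unfold_in.
have kE := divz_eq k n.
suff r0 : (k %% n)%Z = 0.
  rewrite kE r0 addr0 -mulrzr rmorphM /= mulrC mulfK//; exact: intr_int.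
apply: contrapT => /eqP r0.
have r_ge0 : 0 <= (k %% n)%Z by rewrite modz_ge0// -lt0n.
have : (n <= `|(k %% n)%Z|)%N.
  apply: nmin; rewrite absz_gt0 r0 /=.
  have : x *~ (k %% n)%Z = 0.
    move: xk; rewrite {1}kE mulrzDr mulrC mulrzA -pmulrn xn0 mul0rz add0r.
    by [].
  by case: (k %% n)%Z r_ge0 => // m _ /eqP.
have : (k %% n)%Z < n%:Z by apply: ltz_pmod.
by lia.
Qed.

(** * Topological abelian groups *)

Section GroupTopology.
Variable A : topologicalZmodType.
Implicit Types (x y : A) (W V : set A).

Lemma shift_near x y W : nbhs (x + y) W -> nbhs y [set z | W (x + z)].
Proof.
move=> /add_near[P [Q [xP yQ PQ]]].
by apply: filterS yQ => b; apply: PQ; exact: nbhs_singleton.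
Qed.

Lemma nbhs_shift x W : nbhs x W <-> nbhs 0 [set y | W (x + y)].
Proof.
split=> [xW|]; first by apply: shift_near; rewrite addr0.
rewrite -{1}(addNr x) => /shift_near; apply: filterS => y /=.
by rewrite addNKr.
Qed.

Lemma sub_near0 W : nbhs (0 : A) W ->
  exists2 V, nbhs (0 : A) V & forall x y, V x -> V y -> W (x - y).
Proof.
rewrite -{1}(subrr 0) => /sub_near[P [Q [P0 Q0 PQ]]].
by exists (P `&` Q); [exact: filterI|move=> x y [Px _] [_ Qy]; exact: PQ].
Qed.

Lemma add_near0 W : nbhs (0 : A) W ->
  exists2 V, nbhs (0 : A) V & forall x y, V x -> V y -> W (x + y).
Proof.
rewrite -{1}(addr0 0) => /add_near[P [Q [P0 Q0 PQ]]].
by exists (P `&` Q); [exact: filterI|move=> x y [Px _] [_ Qy]; exact: PQ].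
Qed.

Lemma nbhs_sub x V : nbhs (0 : A) V -> nbhs x [set y | V (x - y)].
Proof.
rewrite -(subrr x) => /sub_near[P [Q [xP xQ PQ]]].
by apply: filterS xQ => y; apply: PQ; exact: nbhs_singleton.
Qed.

Lemma nbhs_subr x V : nbhs (0 : A) V -> nbhs x [set y | V (y - x)].
Proof.
rewrite -(subrr x) => /sub_near[P [Q [xP xQ PQ]]].
by apply: filterS xP => y Py; apply: PQ => //; exact: nbhs_singleton.
Qed.

Lemma hausdorff_separates0 : hausdorff_space A -> forall x, x != 0 ->
  exists2 W, nbhs (0 : A) W & ~ W x.
Proof.
move=> hA x x0; apply: contrapT => no; move/eqP: x0; apply; apply: hA => P Q.
move=> xP Q0; have /sub_near[P' [Q' [P'x Q'0 PQ']]] : nbhs (x - 0) P.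
  by rewrite subr0.
apply: contrapT => PQ; apply: no.
exists (Q `&` Q') => [|[Qx _]]; first exact: filterI.
by apply: PQ; exists x; split => //; exact: nbhs_singleton.
Qed.

Lemma separates0_hausdorff : (forall x, x != 0 ->
  exists2 W, nbhs (0 : A) W & ~ W x) -> hausdorff_space A.
Proof.
move=> sep p q pq; apply/eqP; rewrite -subr_eq0; apply: contrapT => /negP.
move=> /sep[W /sub_near0[V V0 VW]]; apply.
have [y [/= py qy]] := pq _ _ (nbhs_sub p V0) (nbhs_sub q V0).
by have := VW _ _ py qy; rewrite opprB addrA subrK.
Qed.

Lemma closure_sub x V E : nbhs (0 : A) V -> closure E x ->
  exists2 y, E y & V (x - y).
Proof. by move=> V0 /(_ _ (nbhs_sub x V0))[y [Ey /= xy]]; exists y. Qed.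

Lemma subgrp_open (S : set A) : subgrp S -> nbhs (0 : A) S -> open S.
Proof.
move=> sS S0; rewrite openE => x Sx; apply/nbhs_shift.
by apply: filterS S0 => y Sy; exact: subgrpD.
Qed.

Lemma subgrp_closed (S : set A) : subgrp S -> nbhs (0 : A) S -> closed S.
Proof.
move=> sS S0 x /(closure_sub S0)[y Sy Sxy].
by rewrite -(subrK y x); exact: subgrpD.
Qed.

Lemma open_near0 (W : set A) :
  open W <-> forall x, W x -> nbhs (0 : A) [set y | W (x + y)].
Proof.
rewrite openE; split=> oW x Wx;
  first by exact: (proj1 (nbhs_shift x W) (oW x Wx)).
by apply: (proj2 (nbhs_shift x W)); exact: oW.
Qed.

Lemma nbhs0_N W : nbhs (0 : A) W -> nbhs (0 : A) [set x | W (- x)].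
Proof.
by move=> /(@nbhs_sub 0); apply: filterS => x /=; rewrite sub0r.
Qed.

End GroupTopology.

Section Homs.
Variables A B : topologicalZmodType.

Lemma hom_continuous (f : A -> B) : zmod_morphism f ->
  (forall W, nbhs 0 W -> nbhs 0 (f @^-1` W)) -> continuous f.
Proof.
move=> fm f0 x W /nbhs_shift/f0 xW; apply/nbhs_shift; apply: filterS xW => y /=.
by rewrite (zmod_morphD fm).
Qed.

Lemma hom_open (f : A -> B) : zmod_morphism f ->
  (forall V, nbhs 0 V -> nbhs 0 (f @` V)) -> forall U, open U -> open (f @` U).
Proof.
move=> fm f0 U /open_near0 oU; apply/open_near0 => _ [x /oU/f0 xU <-].
apply: filterS xU => _ [y /= Uxy <-].
by exists (x + y) => //; rewrite (zmod_morphD fm).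
Qed.

Lemma open_map_near0 (f : chom A B) : open_embedding f ->
  forall V, nbhs 0 V -> nbhs 0 (f @` V).
Proof.
move=> [_ _ of_] V; rewrite nbhsE => -[V' [oV' V'0] V'V].
apply: (@filterS _ _ _ (f @` V')); first exact: image_subset.
by apply: open_nbhs_nbhs; split; [exact: of_|exists 0 => //; exact: chom0].
Qed.

Lemma chom_near0 (f : chom A B) W : nbhs 0 W -> nbhs 0 (f @^-1` W).
Proof. by move=> W0; apply: (@chom_continuous _ _ f 0); rewrite chom0. Qed.

Lemma hom_is_chom (f : A -> B) : zmod_morphism f ->
  (forall W, nbhs 0 W -> nbhs 0 (f @^-1` W)) -> f \in @is_chom A B.
Proof. by move=> fm f0; apply/asboolP; split=> //; exact: hom_continuous. Qed.

Lemma LCA_compact_nbhs : LCA A -> exists2 K : set A, nbhs 0 K & compact K.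
Proof.
move=> [hA /(_ 0 I)[K K0 [cK _]]]; exists K => //.
by apply: (@filterS _ (nbhs (0 : A)) _ _ _ _ K0) => x; apply.
Qed.

(** The target of an open embedding is covered by translates of the image,
    which give it compact neighbourhoods; a point outside of the image is
    separated from 0 by the image itself. So local compactness of the big
    groups below never has to be proved from their definition. *)
Lemma LCA_open_embedding (f : chom A B) : LCA A -> open_embedding f -> LCA B.
Proof.
move=> lA ef; have [cf fi of_] := ef.
have f0 := open_map_near0 ef.
have hB : hausdorff_space B.
  apply: separates0_hausdorff => y y0.
  have [[x _ fx]|nim] := pselect ((f @` setT) y); last first.
    by exists (f @` setT) => //; apply: f0; exact: filterT.
  have x0 : x != 0 by apply: contra y0 => /eqP xE; rewrite -fx xE chom0.
  have [W W0 Wx] := hausdorff_separates0 lA.1 x0.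
  exists (f @` W); first exact: f0.
  by move=> [z Wz zy]; apply: Wx; rewrite (fi x z)// zy fx.
split=> // y _; have [K K0 cK] := LCA_compact_nbhs lA.
have cfK : compact ((fun x => y + f x) @` K).
  apply: continuous_compact => //; apply/continuous_subspaceT => x.
  by move=> W /shift_near/(@chom_continuous _ _ f).
exists ((fun x => y + f x) @` K); last by split=> //; exact: compact_closed.
suff Ky : nbhs y ((fun x => y + f x) @` K).
  by apply: (@filterS _ (nbhs y) _ _ _ _ Ky) => x.
apply/nbhs_shift; apply: filterS (f0 _ K0) => _ [x Kx <-]; by exists x.
Qed.

End Homs.

(** * Divisible hulls *)

Section OpenExtension.
Variables (A : topologicalZmodType) (D : zmodType) (f : A -> D).

(** [D] with the only group topology for which [f] is an open embedding. The
    hypotheses on [f] are parameters because continuity of subtraction relies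
    on them. *)
Definition open_extension of zmod_morphism f & injective f : Type := D.

Hypotheses (fm : zmod_morphism f) (fi : injective f).
Local Notation E := (open_extension fm fi).

HB.instance Definition _ := GRing.Zmodule.copy E D.

Definition extension_open (W : set E) : Prop :=
  forall d : D, open [set a | W (d + f a)].

Let extension_openT : extension_open setT.
Proof. by move=> d; exact: openT. Qed.

Let extension_openI : setI_closed extension_open.
Proof. by move=> V W oV oW d; exact: (openI (oV d) (oW d)). Qed.

Let extension_open_bigU (J : Type) (g : J -> set E) :
  (forall j, extension_open (g j)) -> extension_open (\bigcup_j g j).
Proof.
move=> og d; apply: (@bigcup_open _ _ _ (fun j => [set a | g j (d + f a)])).
by move=> j _; exact: og.
Qed.

HB.instance Definition _ := isOpenTopological.Build E
  extension_openT extension_openI extension_open_bigU.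

Lemma extension_openE (W : set E) : open W = extension_open W.
Proof. by []. Qed.

Lemma extension_image_open (d : E) (V : set A) : open V ->
  open [set d + f a | a in V].
Proof.
move=> oV; rewrite extension_openE => d'.
have [[c dd']|no] := pselect (exists c, d' = d + f c).
  rewrite (_ : [set a | _] = (fun a => a + c) @^-1` V).
    have := @open_comp A A (fun a => a + c) V; apply => // x _.
    by move=> W; rewrite addrC => /shift_near; apply: filterS => y /=;
      rewrite addrC.
  have E a : d' + f a = d + f (a + c).
    by rewrite dd' [a + c]addrC (zmod_morphD fm) addrA.
  apply/seteqP; split=> a /=; rewrite E; last by move=> Vac; exists (a + c).
  by move=> [v Vv vE]; move/addrI/fi : vE => <-.
rewrite (_ : [set a | _] = set0); first exact: open0.
rewrite -subset0 => a /= [v _ vE]; apply: no; exists (v - a).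
by rewrite fm addrA vE addrK.
Qed.

Lemma extension_nearP (d : E) (W : set E) :
  nbhs d W <-> nbhs 0 [set a | W (d + f a)].
Proof.
split.
  rewrite nbhsE => -[W' [oW' W'd] W'W].
  have : nbhs 0 [set a | W' (d + f a)].
    by apply: open_nbhs_nbhs; split;
      [exact: oW'|rewrite /= (zmod_morph0 fm) addr0].
  by apply: filterS => a /W'W.
rewrite nbhsE => -[V [oV V0] VW].
rewrite nbhsE; exists [set d + f a | a in V]; last by move=> _ [a /VW ? <-].
split; first exact: extension_image_open.
by exists 0 => //; rewrite (zmod_morph0 fm) addr0.
Qed.

Lemma extension_sub_continuous : continuous (fun x : E * E => x.1 - x.2).
Proof.
apply: continuous_pair_near => x y W oW Wxy.
have /extension_nearP/sub_near0[V V0 VW] : nbhs (x - y) W.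
  by apply: open_nbhs_nbhs; split.
exists [set x + f a | a in V], [set y + f a | a in V]; split.
- by apply/extension_nearP; apply: filterS V0 => a Va; exists a.
- by apply/extension_nearP; apply: filterS V0 => a Va; exists a.
- move=> _ _ [a Va <-] [b Vb <-]; rewrite opprD addrACA.
  by have := VW _ _ Va Vb; rewrite /= fm.
Qed.

HB.instance Definition _ :=
  PreTopologicalNmodule_isTopologicalZmodule.Build E extension_sub_continuous.

Lemma extension_is_chom : (f : A -> E) \in @is_chom A E.
Proof.
apply: hom_is_chom => // W /extension_nearP.
by apply: filterS => a /=; rewrite add0r.
Qed.

Definition extension_map : chom A E := Chom extension_is_chom.

Lemma extension_map_open : open_embedding extension_map.
Proof.
split=> [||U oU]; [exact: chom_continuous|exact: fi|].
apply: hom_open => // V V0; apply/extension_nearP.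
by apply: filterS V0 => a Va; exists a => //=; rewrite add0r.
Qed.

End OpenExtension.

(** Essential extensions are the minimal ones: unlike an arbitrary divisible
    group containing [A], such an extension acquires no torsion of prime
    order beyond that of [A]. *)
Definition essential (A D : zmodType) (f : A -> D) : Prop :=
  forall x, x != 0 -> exists (k : int) (a : A), x *~ k = f a /\ x *~ k != 0.

Lemma gprodMn (I : Type) (G : I -> topologicalZmodType) (x : gprod G) n i :
  (x *+ n) i = x i *+ n.
Proof. by elim: n => [//|n IH]; rewrite !mulrS gprodD IH. Qed.

Lemma gprod_divisible (I : Type) (G : I -> topologicalZmodType) :
  (forall i, divisible (G i)) -> divisible (gprod G).
Proof.
move=> divG n n0 x; exists (fun i => sval (cid (divG i n n0 (x i)))).
apply: functional_extensionality_dep => i; rewrite gprodMn.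
exact: svalP (cid (divG i n n0 (x i))).
Qed.

Section Hull.
Variables (R : realType) (A : zmodType).

Let char : Type := {h : A -> circle R | zmod_morphism h}.
Let prod : topologicalZmodType := gprod (fun _ : char => circle R).
Let ev (a : A) : prod := fun h => sval h a.

Let ev_morphism : zmod_morphism ev.
Proof.
by move=> x y; apply: functional_extensionality_dep => -[h hm]; exact: hm.
Qed.

Let ev_inj : injective ev.
Proof.
apply: (hom_inj ev_morphism) => a a0; apply: contrapT.
move=> /eqP /(character_separates R)[h hm].
have /(congr1 (fun g => g (exist _ h hm))) := a0.
by rewrite /ev /= => ->; rewrite eqxx.
Qed.

(** [A] embeds in a power of the circle through all its characters. Dividing
    out a subgroup [M] maximal among those meeting [A] trivially keeps
    divisibility and the embedding, and makes it essential: if no multiple of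
    [x] outside of [M] lay in [M + A], then [x] could be added to [M]. *)
Lemma divisible_hull : exists (D : zmodType) (f : A -> D),
  [/\ divisible D, zmod_morphism f, injective f & essential f].
Proof.
pose good (M : set prod) := subgrp M /\ forall a, M (ev a) -> a = 0.
(* The empty chain requires the union with 0. *)
have [C|M' [gM maxM]] := @Zorn_bigcup prod (fun X => good ([set 0] `|` X)).
  move=> CP tot; split.
    split; first by left.
    have inC X x : C X -> ([set 0] `|` X) x ->
        ([set 0] `|` \bigcup_(X in C) X) x.
      by move=> CX [x0|Xx]; [left|right; exists X].
    move=> x y [->|[X CX Xx]] [->|[Y CY Yy]].
    - by left; rewrite /= subrr.
    - by apply: (inC Y) => //; apply: (subgrpB (CP _ CY).1); [left|right].
    - by apply: (inC X) => //; apply: (subgrpB (CP _ CX).1); [right|left].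
    - have [XY|YX] := tot _ _ CX CY.
        apply: (inC Y) => //; apply: (subgrpB (CP _ CY).1); right => //.
        exact: XY.
      apply: (inC X) => //; apply: (subgrpB (CP _ CX).1); right => //.
      exact: YX.
  move=> a [a0|[X CX Xa]]; last by apply: (CP _ CX).2; right.
  by apply: ev_inj; rewrite a0 (zmod_morph0 ev_morphism).
set M := [set 0] `|` M' in gM maxM; have sM := gM.1.
exists (gquot (subgrp_pred sM)), (gproj (subgrp_pred sM) \o ev).
have fm : zmod_morphism (gproj (subgrp_pred sM) \o ev).
  by move=> x y /=; rewrite ev_morphism gprojB.
split=> //.
- apply: gquot_divisible; apply: gprod_divisible => _.
  exact: circle_divisible.
- apply: (hom_inj fm) => a /= /gproj_eq0/subgrp_predP; exact: gM.2.
- move=> q q0; have [x xq] := gproj_surj q; move: q0; rewrite -{q}xq => x0.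
  have nMx : ~ M x.
    by move=> Mx; move/eqP: x0; apply; apply/gproj_eq0/subgrp_predP.
  pose N := [set y | exists2 m, M m & exists k : int, y = m + x *~ k].
  have sN : subgrp N.
    split.
      by exists 0; [exact: (subgrp0 sM)|exists 0; rewrite mulr0z addr0].
    move=> _ _ [m Mm [k ->]] [m' Mm' [k' ->]].
    exists (m - m'); first exact: (subgrpB sM).
    by exists (k - k'); rewrite mulrzBr opprD addrACA.
  have MN : M `<=` N.
    by move=> m Mm; exists m => //; exists 0; rewrite mulr0z addr0.
  have NE : [set 0] `|` N = N by apply/setUidPr => _ ->; exact: (subgrp0 sN).
  have : ~ good N.
    move=> gN; apply: (maxM N); last by rewrite NE.
    split; first by move=> m M'm; apply: MN; right.
    move=> NM'; apply: nMx; right; apply: NM'.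
    by exists 0; [exact: (subgrp0 sM)|exists 1; rewrite mulr1z add0r].
  move=> /not_andP[//|/existsNP[a /not_implyP[[m Mm [k ak]] a0]]].
  exists k, a; rewrite /= ak gprojD gprojMz.
  have -> : gproj (subgrp_pred sM) m = 0 by apply/gproj_eq0/subgrp_predP.
  rewrite add0r; split=> //; apply/eqP; rewrite -gprojMz =>
    /gproj_eq0/subgrp_predP Mk.
  by apply: a0; apply: gM.2; rewrite ak; exact: (subgrpD sM).
Qed.

End Hull.

Section EssentialExtension.
Variables (A D : topologicalZmodType) (f : chom A D).
Hypothesis essf : essential f.

Lemma essential_torsion : torsion (gquot (chom_im f)).
Proof.
move=> q; have [x <-] := gproj_surj q.
have [->|x0] := eqVneq x 0; first by exists 1%N => //; rewrite gproj0 mulr1n.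
have [k [a [ka k0]]] := essf x0.
have kn0 : k != 0 by apply: contra k0 => /eqP ->; rewrite mulr0z.
exists `|k|%N; first by rewrite absz_gt0.
rewrite -gprojMn; apply/gproj_eq0/asboolP.
case: k {k0 kn0} ka => n; first by move=> ka; exists a; rewrite -ka.
rewrite NegzE mulrNz abszN => ka.
by exists (- a); rewrite chomN -ka opprK.
Qed.

(** Some multiple [x *~ k] is a non-zero element of the image; as [x] has
    order [p], the integer [k] is prime to [p], and [x] is in turn a multiple
    of [x *~ k]. *)
Lemma essential_kernel p (x : D) : prime p -> x *+ p = 0 -> exists a, x = f a.
Proof.
move=> pp xp; have [->|x0] := eqVneq x 0; first by exists 0; rewrite chom0.
have [k [a [ka k0]]] := essf x0.
have : coprimez k p.
  rewrite coprimez_sym coprimezE /= prime_coprime//.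
  apply: contra k0 => /dvdnP[m mE].
  have : x *+ `|k| = 0 by rewrite mE mulnC mulrnA xp mul0rn.
  by case: k {mE ka} => n; rewrite ?NegzE ?abszN ?mulrNz -?pmulrn => ->;
    rewrite ?oppr0.
move=> /coprimezP[[u v] /= uv1]; exists (a *~ u).
rewrite (zmod_morphMz (chomB f)) -ka -mulrzA mulrC.
have : x *~ (u * k + v * p) = x by rewrite uv1 mulr1z.
by rewrite mulrzDr [v * _]mulrC !mulrzA -!pmulrn xp mul0rz addr0 -mulrzA => ->.
Qed.

End EssentialExtension.

(** * Finite ranks *)

(** Openness of multiplication by [n], at 0. It is the part of the finite
    rank conditions that is inherited by open subgroups, by direct summands
    and by extensions in which [A] is open. *)
Definition mul_open (A : topologicalZmodType) (n : nat) : Prop :=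
  forall V : set A, nbhs 0 V -> nbhs 0 [set x *+ n | x in V].

(** The complement is a finite union of cosets, hence closed. *)
Lemma finite_index_open (A : topologicalZmodType) (H : zmodClosed A) :
  closed [set` H] -> finite_set [set: gquot H] -> nbhs (0 : A) [set` H].
Proof.
move=> cH fH.
have cls (q : gquot H) : closed [set x | gproj H x = q].
  have [y <-] := gproj_surj q.
  rewrite (_ : [set x | _] = (fun x => - y + x) @^-1` [set` H]).
    apply: closed_comp => // x _; apply: (@shift_near A (- y) x).
  by apply/seteqP; split=> x /=; rewrite addrC => /gproj_eq.
have cN : closed (\bigcup_(q in [set q : gquot H | q != 0]) [set x | gproj H x
  = q]).
  apply: closed_bigcup => //; apply: sub_finite_set fH => //.
have : nbhs (0 : A) (~` \bigcup_(q in [set q : gquot H | q != 0]) [set x |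
  gproj H x = q]).
  apply: open_nbhs_nbhs; split; first exact: closed_openC.
  by move=> [q /= q0 qE]; rewrite -qE gproj0 eqxx in q0.
apply: filterS => x /= nx; apply/gproj_eq0; apply: contrapT => /eqP x0.
by apply: nx; exists (gproj H x).
Qed.

(** The image is closed of finite index, hence open, and the induced closed
    embedding of the quotient is a homeomorphism onto it. *)
Lemma strict_open (A B : topologicalZmodType) (f : chom A B) : strict f ->
  finite_set [set: gquot (chom_im f)] ->
  forall V, nbhs 0 V -> nbhs 0 (f @` V).
Proof.
move=> [_ fi fc] fin V V0.
have im0 : nbhs (0 : B) [set` chom_im f].
  apply: finite_index_open => //.
  rewrite (_ : [set` _] = induced f @` setT); first by apply: fc;
    exact: closedT.
  apply/seteqP; split=> [y /asboolP[x <-]|_ [q _ <-]].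
    by exists (gproj _ x) => //; rewrite inducedE.
  by apply/asboolP; exists (repr q).
pose W := (gproj (chom_ker f) @` V)°.
have W0 : W (gproj (chom_ker f) 0).
  by apply/gproj_near; apply: filterS V0 => x Vx; exists x.
have : nbhs 0 (~` (induced f @` (~` W))).
  apply: open_nbhs_nbhs; split.
    by apply/closed_openC/fc/open_closedC; exact: open_interior.
  move=> [q nWq q0]; apply: nWq; suff <- : gproj (chom_ker f) 0 = q by [].
  by apply: fi; rewrite inducedE chom0 q0.
move=> /(filterI im0); apply: filterS => _ [/asboolP[x <-]] nx.
have : W (gproj (chom_ker f) x).
  by apply: contrapT => nW; apply: nx; exists (gproj (chom_ker f) x) => //;
    rewrite inducedE.
move=> /interior_subset[v Vv vx]; exists v => //.
by rewrite -!inducedE vx.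
Qed.

Lemma surjective_open_strict (A B : topologicalZmodType) (f : chom A B) :
  (forall y, exists x, f x = y) ->
  (forall V, nbhs 0 V -> nbhs 0 (f @` V)) -> strict f.
Proof.
move=> fs f0.
have fi : injective (induced f).
  move=> q q'; have [x <-] := gproj_surj q; have [x' <-] := gproj_surj q'.
  rewrite !inducedE => xx'; apply/gproj_eq.
  by rewrite unfold_in chomB xx' subrr.
split=> //.
- move=> q; have [x <-] := gproj_surj q => W; rewrite inducedE => Wx.
  apply/gproj_near; apply: (@filterS _ (nbhs x) _ (f @^-1` W)).
    by move=> a; rewrite /= inducedE.
  exact: (@chom_continuous _ _ f x).
- move=> C cC; rewrite -[induced f @` C]setCK; apply: open_closedC.
  rewrite (_ : ~` _ = f @` (gproj (chom_ker f) @^-1` (~` C))).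
    apply: hom_open => //; first exact: chomB.
    apply: open_comp; last exact: closed_openC.
    by move=> x _ W /gproj_near.
  apply/seteqP; split=> [y ny|_ [x Cx <-] [q Cq qx]].
    have [x xy] := fs y; exists x => //= Cx; apply: ny.
    by exists (gproj (chom_ker f) x) => //; rewrite inducedE.
  by apply: Cx; rewrite /= -(fi q (gproj _ x))// inducedE.
Qed.

Lemma mul_open_prime (A : topologicalZmodType) :
  (forall p, prime p -> mul_open A p) -> forall n, (0 < n)%N -> mul_open A n.
Proof.
move=> Ap n; elim/ltn_ind: n => n IH n0 V V0.
have [n1|n1] := leqP n 1.
  have -> : n = 1%N by apply/eqP; rewrite eqn_leq n1.
  by apply: filterS V0 => x Vx; exists x.
have pp := pdiv_prime n1; have nE := divnK (pdiv_dvd n).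
have m0 : (0 < n %/ pdiv n)%N
  by rewrite divn_gt0 ?pdiv_gt0// dvdn_leq ?pdiv_dvd.
have mn : (n %/ pdiv n < n)%N by rewrite ltn_Pdiv// prime_gt1.
apply: filterS (Ap _ pp _ (IH _ mn m0 _ V0)) => _ [_ [x Vx <-] <-].
by exists x => //; rewrite -mulrnA nE.
Qed.

Lemma finite_ranks_mul_open (R : realType) (A : topologicalZmodType) :
  finite_ranks R A -> forall n, (0 < n)%N -> mul_open A n.
Proof.
move=> [_ _ fr]; apply: mul_open_prime => p /fr[sp _ fp] V V0.
exact: (strict_open sp fp).
Qed.

Section FiniteRanks.
Variables (R : realType) (A D : topologicalZmodType) (f : chom A D).
Hypotheses (frA : finite_ranks R A) (divD : divisible D).
Hypotheses (ef : open_embedding f) (essf : essential f).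

Let f0 := open_map_near0 ef.
Let fi : injective f. Proof. by case: ef. Qed.

(** The real line is divisible and torsion-free while [D/A] is torsion, so
    that homomorphisms to it extend uniquely from [A] to [D]; the extensions
    are continuous because [A] is open. *)
Lemma extension_dual_dim : finite_dimensional (chom D R^o : lmodType R).
Proof.
have [[n [e eP]] _ _] := frA.
have ext (g : chom A R^o) : exists h : chom D R^o, forall a, h (f a) = g a.
  have divR : divisible R^o := @divisible_field R.
  pose Gam := [set y : D * R^o | exists a, y = (f a, g a)].
  have [|h hm hG] := @divisible_extend D R^o divR Gam.
    split; last by move=> d [a [/esym fa ->]];
      rewrite (fi (etrans fa (esym (chom0 f)))) chom0.
    split; first by exists 0; rewrite !chom0.
    by move=> _ _ [a ->] [b ->]; exists (a - b); rewrite !chomB.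
  have hf a : h (f a) = g a by apply: hG; exists a.
  suff hc : (h : D -> R^o) \in @is_chom D R^o by exists (Chom hc).
  apply: hom_is_chom => // W /(chom_near0 g)/f0; apply: filterS => _ [a ga <-].
  by rewrite /= hf.
exists n, (fun i => sval (cid (ext (e i)))) => v.
have vfP : (fun a => v (f a)) \in @is_chom A R^o.
  apply: hom_is_chom; first by move=> x y; rewrite !chomB.
  by move=> W /(chom_near0 v)/(chom_near0 f).
have [c cE] := eP (Chom vfP); exists c.
apply/val_inj/funext => d /=.
have [m m0 [a da]] : exists2 m, (0 < m)%N & exists a, d *+ m = f a.
  have [m m0] := essential_torsion essf (gproj (chom_im f) d).
  by rewrite -gprojMn => /gproj_eq0/asboolP[a ad]; exists m => //; exists a.
have sumE (B : topologicalZmodType) (s : 'I_n -> chom B R^o) x :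
    (\sum_i c i *: s i) x = \sum_i c i *: s i x.
  by elim/big_rec2 : _ => [//|i y1 y2 _ <-].
have mR : m%:R != 0 :> R by rewrite pnatr_eq0 -lt0n.
apply: (mulIf mR).
have M (h : chom D R^o) : h d * m%:R = h (f a).
  by rewrite -da mulr_natr; exact/esym/(zmod_morphMn (chomB h)).
rewrite !M sumE.
have := congr1 (fun h : chom A R^o => h a) cE; rewrite sumE /= => ->.
by apply: eq_bigr => i _; rewrite (svalP (cid (ext (e i)))).
Qed.

(** The real line is generated by any neighbourhood of 0. *)
Lemma open_subgrp_line (S : set R) : subgrp S -> nbhs (0 : R) S ->
  forall x, S x.
Proof.
move=> sS /nbhs_ballP[e /= e0 eS] x.
pose n := (Num.truncn (`|x| / e)).+1.
have n0 : (0 : R) < n%:R by rewrite ltr0n.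
have -> : x = (x / n%:R) *+ n by rewrite -[RHS]mulr_natr divfK// gt_eqF.
apply: subgrpMn => //; apply: eS; rewrite -ball_normE /= sub0r normrN.
rewrite normrM normfV (gtr0_norm n0) ltr_pdivrMr// mulrC -ltr_pdivrMr//.
exact: truncnS_gt.
Qed.

(** The preimage of the open subgroup [A] under a one-parameter subgroup of
    [D] is an open subgroup of the line, so that the whole of it lands in
    [A]. *)
Lemma extension_one_param_dim : finite_dimensional (one_param R D : lmodType R).
Proof.
have [_ [n [e eP]] _] := frA.
have compP (g : chom R A) : f \o g \in @is_chom R D.
  apply: hom_is_chom; first by move=> x y /=; rewrite !chomB.
  by move=> W /(chom_near0 f)/(chom_near0 g).
exists n, (fun i => Chom (compP (e i)) : one_param R D) => v.
have vim x : exists a, v x = f a.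
  have S0 : nbhs (0 : R) [set x | exists a, v x = f a].
    have fT : nbhs 0 (range f) by apply: f0; exact: filterT.
    have := chom_near0 (v : chom R D) fT.
    by apply: filterS => y [a _ fa]; exists a; exact: esym.
  apply: (open_subgrp_line _ S0); split; first by exists 0; rewrite !chom0.
  by move=> y z [a ya] [b zb]; exists (a - b); rewrite !chomB ya zb.
pose w x := sval (cid (vim x)).
have wP x : v x = f (w x) by exact: svalP (cid (vim x)).
have wm : zmod_morphism w by move=> x y; apply: fi; rewrite chomB -!wP chomB.
have wc : w \in @is_chom R A.
  apply: hom_is_chom => // W /f0/(chom_near0 (v : chom R D)); apply: filterS =>
    x [a Wa fa].
  have wa : a = w x by apply: fi; rewrite -wP.
  by rewrite /= -[W _]/(W (w x)) -wa.
have [c cE] := eP (Chom wc : one_param R A); exists c.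
apply/val_inj/funext => x /=.
have sumE (B : topologicalZmodType) (s : 'I_n -> one_param R B) :
    (\sum_i c i *: s i : one_param R B) x = \sum_i s i (c i * x).
  by elim/big_rec2 : _ => [//|i y1 y2 _ <-].
rewrite sumE wP; have := congr1 (fun h : one_param R A => h x) cE.
rewrite sumE /= => ->.
elim/big_rec2 : _ => [|i y1 y2 _ <-]; first exact: chom0.
by rewrite chomD.
Qed.

(** Multiplication by [p] is onto [D], is open because it is so on the open
    subgroup [A], and has its kernel in [A] because [A] is essential. *)
Lemma extension_finite_ranks : finite_ranks R D.
Proof.
split; [exact: extension_dual_dim|exact: extension_one_param_dim|].
move=> p pp; have p0 := prime_gt0 pp; have [_ _ /(_ p pp)[_ fK _]] := frA.
split.
- apply: surjective_open_strict => [y|V V0]; first by have [x] := divD p0 y;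
    exists x.
  have := f0 (finite_ranks_mul_open frA p0 (chom_near0 f V0)).
  apply: filterS => _ [_ [a Va <-] <-]; exists (f a) => //=.
  by rewrite (zmod_morphMn (chomB f)).
- apply: (sub_finite_set _ (finite_image f fK)) => x.
  rewrite /= unfold_in => /eqP xp; have [a xa] := essential_kernel essf pp xp.
  exists a => //; rewrite /= unfold_in; apply/eqP/fi.
  by rewrite /= (zmod_morphMn (chomB f)) -xa chom0.
- apply: (sub_finite_set _ (finite_set1 0)) => q _ /=.
  have [x <-] := gproj_surj q; apply/gproj_eq0/asboolP.
  by have [y] := divD p0 x; exists y.
Qed.

End FiniteRanks.

Lemma LCA_divisible_hull (R : realType) (A : topologicalZmodType) : LCA A ->
  exists (D : topologicalZmodType) (f : chom A D),
    divisible_extension f /\ essential f.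
Proof.
move=> lA; have [D [f [divD fm fi essf]]] := divisible_hull R A.
exists (open_extension fm fi), (extension_map fm fi).
have ef := extension_map_open fm fi.
split=> //; split=> //; first exact: LCA_open_embedding ef.
exact: essential_torsion.
Qed.

(** * Compact open subgroups of topological torsion groups *)

Section Compactness.
Variable T : topologicalZmodType.
Implicit Types (K W V : set T).

Lemma compact_nested K (C : nat -> set T) : compact K ->
  (forall n, closed (C n)) -> (forall m n, (m <= n)%N -> C n `<=` C m) ->
  (forall n, exists2 x, K x & C n x) -> exists2 x, K x & forall n, C n x.
Proof.
move=> cK clC decC C0; apply: contrapT => no.
have cov : forall x, K x -> \forall x' \near x & n \near \oo, ~ C n x'.
  move=> x Kx; have /existsNP[n nCx] : ~ forall n, C n x.
    by move=> Cx; apply: no; exists x.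
  exists (~` C n, [set m | (n <= m)%N]) => /=.
    split; last by exists n.
    by apply: open_nbhs_nbhs; split=> //; exact: closed_openC.
  by move=> [y m] [/= nCy nm] /(decC _ _ nm).
have [/= N _ /(_ N (leqnn N)) KC] :=
  (compact_near_coveringP K).1 cK nat \oo _ _ cov.
by have [x Kx] := C0 N; exact: KC.
Qed.

(** Finite subcovers indexed by sequences, through the filter of the finite
    sequences ordered by inclusion. *)
Lemma compact_seq_cover K (f : T -> set T) : compact K ->
  (forall x, K x -> nbhs x (f x)) ->
  exists s : seq T, forall x, K x -> exists2 y, y \in s & f y x.
Proof.
move=> cK fK.
pose F : set_system (seq T) := filter_from setT
    (fun s : seq T => [set s' : seq T | {subset s <= s'}]).
have FF : Filter F.
  apply: filter_from_filter; first by exists [::].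
  move=> s s' _ _; exists (s ++ s') => // r /= sr.
  by split=> y ys; apply: sr; rewrite mem_cat ys ?orbT.
have cov : forall x, K x -> \forall x' \near x & s \near F,
    exists2 y, y \in s & f y x'.
  move=> x Kx; exists (f x, [set s : seq T | {subset [:: x] <= s}]) => /=.
    by split; [exact: fK|exists [:: x]].
  by move=> [y s] [/= fxy xs]; exists x => //; apply: xs; rewrite inE.
have [/= s _ /(_ s) sK] := (compact_near_coveringP K).1 cK _ _ _ FF cov.
by exists s => x Kx; exact: sK.
Qed.

Lemma compact_sum K L : compact K -> compact L ->
  compact [set x + y | x in K & y in L].
Proof.
move=> cK cL.
rewrite (_ : [set _ | _ in _ & _ in _] = (fun z : T * T =>
  z.1 + z.2) @` (K `*` L)).
  apply: continuous_compact; last exact: compact_setX.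
  by apply/continuous_subspaceT => z; exact: add_continuous.
apply/seteqP; split=> [_ [x Kx [y Ly <-]]|_ [[x y] [/= Kx Ly] <-]].
  by exists (x, y).
by exists x => //; exists y.
Qed.

Lemma compact_shift x K : compact K -> compact [set x + y | y in K].
Proof.
move=> cK; apply: continuous_compact => //; apply/continuous_subspaceT => y.
by move=> W /shift_near.
Qed.

Lemma LCA_symmetric_nbhs : LCA T ->
  exists W, [/\ nbhs 0 W, compact W & forall x, W x -> W (- x)].
Proof.
move=> lT; have [K K0 cK] := LCA_compact_nbhs lT.
have clK : closed K by apply: compact_closed => //; exact: lT.1.
exists (K `&` [set x | K (- x)]); split.
- by apply: filterI => //; exact: nbhs0_N.
- apply: compact_closedI => //; apply: (@closed_comp _ _ (fun x : T => - x)) =>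
    // x _.
  exact: opp_continuous.
- by move=> x [Kx KNx]; split=> //=; rewrite opprK.
Qed.

Lemma closed_nbhs0 W : nbhs 0 W -> exists V, [/\ nbhs 0 V, closed V & V `<=` W].
Proof.
move=> /add_near0[V V0 VW]; exists (closure V); split.
- by apply: filterS V0; exact: subset_closure.
- exact: closed_closure.
- by move=> x /(closure_sub V0)[y Vy Vxy]; rewrite -(subrK y x); exact: VW.
Qed.

(** Baire: otherwise one builds non-empty open sets, the closure of each one
    lying in the previous one and avoiding one more of the [F n]; a common
    point of the closures is in none of the [F n]. *)
Lemma baire_compact K (F : nat -> set T) : compact K -> open K -> K !=set0 ->
  (forall n, closed (F n)) -> K `<=` \bigcup_n F n ->
  exists n (x : T), nbhs x (F n).
Proof.
move=> cK oK K0 clF KF; apply: contrapT => no.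
have step n V : exists V', open V -> V !=set0 ->
    [/\ open V', V' !=set0 & closure V' `<=` V `\` F n].
  have [oV|?] := pselect (open V); last by exists set0.
  have [V0|?] := pselect (V !=set0); last by exists set0.
  have [x [Vx nFx]] : exists x, (V `\` F n) x.
    apply: contrapT => /forallNP VF; apply: no; case: V0 => x Vx.
    exists n, x; apply: (@filterS _ _ _ V); last exact: open_nbhs_nbhs.
    by move=> y Vy; apply: contrapT => nF; exact: (VF y).
  have : nbhs x (V `\` F n).
    apply: open_nbhs_nbhs; split=> //; apply: openI => //.
    exact: closed_openC.
  move=> /nbhs_shift/add_near0[P P0 PVF].
  exists [set x + y | y in P°] => _ _; split.
  - by apply/open_near0 => _ [y Py <-];
      have /(proj1 (nbhs_shift _ _)) :=
        open_nbhs_nbhs (conj (open_interior P) Py);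
      apply: filterS => z Pz; exists (y + z) => //; rewrite addrA.
  - by exists (x + 0); exists 0 => //; exact: P0.
  - move=> y /(closure_sub P0)[_ [z /interior_subset Pz <-] Pyz].
    by have := PVF _ _ Pz Pyz; rewrite /= addrA [(x + z) + _]addrC subrK.
have [g gP] : exists g : nat -> set T -> set T, forall n V, open V ->
  V !=set0 ->
    [/\ open (g n V), g n V !=set0 & closure (g n V) `<=` V `\` F n].
  exists (fun n V => sval (cid (step n V))) => n V.
  exact: (svalP (cid (step n V))).
pose V := fix V n := if n is m.+1 then g m (V m) else K.
have VP n : open (V n) /\ V n !=set0.
  by elim: n => [//|n [oV V0]]; have [] := gP n _ oV V0.
have VS n : closure (V n.+1) `<=` V n `\` F n.
  by have [oV V0] := VP n; have [] := gP n _ oV V0.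
have Vdec m n : (m <= n)%N -> V n `<=` V m.
  elim: n => [|n IH]; first by rewrite leqn0 => /eqP ->.
  rewrite leq_eqVlt => /predU1P[->//|]; rewrite ltnS => /IH Vnm x Vx.
  by apply: Vnm; have [] := VS n x (subset_closure Vx).
have [x Kx VFx] : exists2 x, K x & forall n, closure (V n.+1) x.
  apply: compact_nested => //.
  - by move=> n; exact: closed_closure.
  - by move=> m n mn; apply: closureS; exact: Vdec.
  - move=> n; have [_ [x Vx]] := VP n.+1; exists x; last exact: subset_closure.
    exact: (Vdec 0%N n.+1).
by have [n _ Fnx] := KF _ Kx; have [] := VS n x (VFx n).
Qed.

End Compactness.

Section TopologicalTorsion.
Variable T : topologicalZmodType.
Hypotheses (lT : LCA T) (ttT : topological_torsion T).

Let fact_near (t : T) (W : set T) : nbhs 0 W ->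
  \forall k \near \oo, W (t *+ k`!).
Proof. by move=> W0; exact: (ttT t W0). Qed.

(** Let [W] be a compact symmetric neighbourhood of 0. Since [t *+ k`!] tends
    to 0, every point of the closure of the group generated by [t] is
    approached by multiples [t *+ j] with [j > 0]; by compactness, bounded
    [j] suffice for the points in [W]. Hence every multiple of [t] is within
    [W] of some [t *+ n] with [n] bounded: the least [n >= 0] doing this can
    be decreased if it exceeds the bound. *)
Lemma multiples_compact (t : T) :
  exists2 K : set T, compact K & forall k : int, K (t *~ k).
Proof.
have [W [W0 cW symW]] := LCA_symmetric_nbhs lT.
pose H : set T := [set x | exists k : int, x = t *~ k].
have cWH : compact (W `&` closure H).
  by apply: compact_closedI => //; exact: closed_closure.
have [N NP] : exists N, forall x, W x -> H x -> exists j,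
    [/\ (0 < j)%N, (j <= N)%N & W (x - t *+ j)].
  have cov : forall x, (W `&` closure H) x -> \forall x' \near x & N \near \oo,
      exists j, [/\ (0 < j)%N, (j <= N)%N & W (x' - t *+ j)].
    move=> x [_ clx]; have [V V0 VW] := add_near0 W0; have [P P0 PV] :=
      add_near0 V0.
    (* A multiple [m] near [x] is made positive by adding a large factorial. *)
    have [_ [m ->] Pxm] := closure_sub P0 clx.
    have [k [Pk mk]] : exists k, P (- (t *+ k`!)) /\ (`|m| < k`!)%N.
      near \oo => k; exists k; split.
        by near: k; exact: (fact_near t (nbhs0_N P0)).
      apply: leq_trans (_ : k <= _)%N; last first.
        by near: k; exists 0%N => // k _; exact: fact_geq.
      by near: k; exact: nbhs_infty_ge.
    have jE : ((absz (m + (k`!)%:Z)))%:Z = m + (k`!)%:Z by lia.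
    exists ([set y | V (y - x)], [set n | (absz (m + (k`!)%:Z)%R <= n)%N]) =>
      /=.
      by split; [exact: nbhs_subr|exact: nbhs_infty_ge].
    move=> [y n] [/= Vyx jn]; exists (absz (m + (k`!)%:Z)); split=> //;
      first by lia.
    have -> : t *+ (absz (m + (k`!)%:Z)) = t *~ m + t *+ k`!.
      by rewrite pmulrn jE mulrzDr -pmulrn.
    have := VW _ _ Vyx (PV _ _ Pxm Pk).
    by rewrite addrA [_ + (x - _)]addrA subrK opprD addrA.
  have [/= N _ /(_ N (leqnn N)) NP] :=
    (compact_near_coveringP _).1 cWH nat \oo _ _ cov.
  by exists N => x Wx Hx; apply: NP; split=> //; exact: subset_closure.
exists (\bigcup_(n < N.+1) [set t *+ n + w | w in W]).
  rewrite bigcup_mkord; apply: bigsetU_compact => i _; exact: compact_shift.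
move=> k.
have exn : exists n, `[< W (t *+ n - t *~ k) >].
  have [l [Wl kl]] : exists l, W (t *+ l`!) /\ (`|k| < l`!)%N.
    near \oo => l; exists l; split; first by near: l; exact: fact_near.
    apply: leq_trans (_ : l <= _)%N; last first.
      by near: l; exists 0%N => // l _; exact: fact_geq.
    by near: l; exact: nbhs_infty_ge.
  exists (absz (k + (l`!)%:Z)); apply/asboolP; rewrite pmulrn.
  have -> : ((absz (k + (l`!)%:Z)))%:Z = k + (l`!)%:Z by lia.
  by rewrite mulrzDr addrAC subrr add0r -pmulrn.
case: (ex_minnP exn) => n /asboolP Wn nmin; exists n; last first.
  by exists (t *~ k - t *+ n); [rewrite -opprB;
    exact: symW|rewrite addrC subrK].
rewrite /= ltnS leqNgt; apply/negP => Nn.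
have [|j [j0 jN Wj]] := NP _ Wn.
  by exists (n%:Z - k); rewrite mulrzBr -pmulrn.
have jn : (j <= n)%N by apply: leq_trans jN (ltnW Nn).
have : (n <= n - j)%N.
  by apply: nmin; apply/asboolP; rewrite mulrnBr// addrAC.
by lia.
Unshelve. all: by end_near. Qed.

Let zspan : seq T -> set T := fix zspan s :=
  if s is t :: s' then
    [set x | exists (k : int) y, zspan s' y /\ x = t *~ k + y]
  else [set 0].

Let zspan_subgrp s : subgrp (zspan s).
Proof.
elim: s => [|t s sS] /=; first by split=> // x y -> ->; exact: subrr.
split; first by exists 0, 0; split; [exact: (subgrp0 sS)|rewrite mulr0z addr0].
move=> _ _ [k [y [Sy ->]]] [l [z [Sz ->]]].
exists (k - l), (y - z); split; first exact: subgrpB.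
by rewrite mulrzBr opprD addrACA.
Qed.

Let zspan_mem s x : x \in s -> zspan s x.
Proof.
elim: s => [//|t s IH]; rewrite inE => /predU1P[->|/IH xs] /=.
  by exists 1, 0; split; [exact: (subgrp0 (zspan_subgrp s))|rewrite addr0].
by exists 0, x; rewrite add0r.
Qed.

Let zspan_compact s : exists2 K, compact K & zspan s `<=` K.
Proof.
elim: s => [|t s [K cK sK]] /=; first by exists [set 0] => //;
  exact: compact_set1.
have [L cL tL] := multiples_compact t.
exists [set x + y | x in L & y in K]; first exact: compact_sum.
by move=> _ [k [y [/sK Ky ->]]]; exists (t *~ k) => //; exists y.
Qed.

(** If [W] is a compact symmetric neighbourhood of 0, then [W + W] is covered
    by finitely many translates of [W]. With the group generated by the
    centres, [W] forms a subgroup, and it is contained in a compact set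
    because the centres have their multiples in compact sets. *)
Lemma compact_open_subgroup :
  exists U : set T, [/\ subgrp U, nbhs 0 U & compact U].
Proof.
have [W [W0 cW symW]] := LCA_symmetric_nbhs lT.
have [s sP] := compact_seq_cover (compact_sum cW cW)
  (f := fun y => [set x | W (x - y)]) (fun x _ => nbhs_subr x W0).
have [K cK sK] := zspan_compact s; have sS := zspan_subgrp s.
pose U := [set x + y | x in W & y in zspan s].
have sU : subgrp U.
  split.
    exists 0; first exact: (nbhs_singleton W0).
    by exists 0; rewrite ?addr0//; exact: (subgrp0 sS).
  move=> _ _ [w Ww [y Sy <-]] [v Wv [z Sz <-]].
  have [|a as_ Wa] := sP (w - v); first by exists w => //; exists (- v);
    [exact: symW|].
  exists (w - v - a) => //; exists (a + (y - z)).
    by apply: (subgrpD sS); [exact: zspan_mem|exact: subgrpB].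
  by rewrite addrA subrK opprD addrACA.
have U0 : nbhs 0 U.
  apply: filterS W0 => x Wx; exists x => //.
  by exists 0; rewrite ?addr0//; exact: (subgrp0 sS).
exists U; split=> //; apply: (subclosed_compact _ (compact_sum cW cK)).
  exact: subgrp_closed.
by move=> _ [w Ww [y /sK Ky <-]]; exists w => //; exists y.
Qed.

(** [U] is the increasing union of the closed sets on which [u *+ k`!]
    remains small for [k >= n]. One of these sets has an interior point [x];
    by translation the convergence is uniform near every point of [U], hence
    on [U] by compactness. *)
Lemma uniform_torsion (U W : set T) : subgrp U -> nbhs 0 U -> compact U ->
  nbhs 0 W -> \forall k \near \oo, forall u, U u -> W (u *+ k`!).
Proof.
move=> sU U0 cU /add_near0[W1 W10 W1W].
have [W2 W20 W21] := sub_near0 W10.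
have [V [V0 clV VW]] := closed_nbhs0 (filterI W10 W20).
pose F n := [set u : T | forall k, (n <= k)%N -> V (u *+ k`!)].
have [|||||n [x xF]] := @baire_compact T U F.
- by [].
- exact: subgrp_open.
- by exists 0; exact: subgrp0.
- move=> n; rewrite (_ : F n = \bigcap_(k in [set k | (n <= k)%N]) (fun u : T
    => u *+ k`!) @^-1` V).
    apply: closed_bigI => k _; apply: closed_comp => // u _.
    exact: (@chom_continuous _ _ (chom_muln T k`!)).
  by apply/seteqP; split=> u Fu k; exact: Fu.
- by move=> u _; have [n _ nV] := fact_near u V0; exists n.
have Fx := nbhs_singleton xF; move: xF => /nbhs_shift xF.
apply: (compact_near_coveringP U).1 => // u Uu.
exists ([set v | F n (x + (v - u))], [set k | (n <= k)%N /\ V (u *+ k`!)]) =>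
  /=.
  split; first exact: (@nbhs_subr T u [set y | F n (x + y)] xF).
  by apply: filterI; [exact: nbhs_infty_ge|exact: fact_near].
move=> [v k] [/= Fv [nk Vu]].
have /VW[_ W2v] := Fv _ nk; have /VW[_ W2x] := Fx _ nk; have /VW[W1u _] := Vu.
(* v k! = (x + (v - u)) k! - x k! + u k! *)
have := W1W _ _ (W21 _ _ W2v W2x) W1u.
by rewrite -mulrnBl addrAC subrr add0r -mulrnDl subrK.
Qed.

End TopologicalTorsion.

(** * The p-adic numbers *)

Section PadicAbs.
Variable p : nat.
Hypothesis pp : prime p.
Local Notation abs := (padic_abs p).

Let p0 : p%:R != 0 :> rat. Proof. by rewrite pnatr_eq0 -lt0n prime_gt0. Qed.
Let p1 : 1 < p%:R :> rat. Proof. by rewrite ltr1n prime_gt1. Qed.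

Lemma padic_absM x y : abs (x * y) = abs x * abs y.
Proof.
have [->|x0] := eqVneq x 0; first by rewrite mul0r padic_abs0 mul0r.
have [->|y0] := eqVneq y 0; first by rewrite mulr0 padic_abs0 mulr0.
rewrite -{1}(divq_num_den x) -{1}(divq_num_den y) mulf_div -!rmorphM /=.
rewrite padic_abs_frac ?mulf_neq0 ?numq_eq0 ?denq_eq0//.
rewrite /padic_abs (negbTE x0) (negbTE y0) -expfzDr//; congr (_ ^ _).
rewrite !abszM !lognM ?absz_gt0 ?numq_eq0 ?denq_eq0//.
by rewrite !PoszD; ring.
Qed.

Lemma padic_abs_intE (c : int) : c != 0 ->
  abs c%:~R = p%:R ^ (- (logn p `|c|)%:Z).
Proof.
move=> c0; rewrite -[c%:~R]divr1 -[1]/(1%:~R) padic_abs_frac//.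
by rewrite logn1 sub0r.
Qed.

Lemma padic_abs_int (c : int) k :
  (abs c%:~R <= p%:R ^- k) = ((p ^ k)%N%:Z %| c)%Z.
Proof.
have [->|c0] := eqVneq c 0.
  by rewrite padic_abs0 dvdz0 invr_ge0 exprn_ge0.
rewrite padic_abs_intE// dvdzE absz_nat pfactor_dvdn ?absz_gt0//.
have -> : p%:R ^- k = p%:R ^ (- k%:Z) :> rat by rewrite -exprnN.
by rewrite ler_eXz2l// lerN2 lez_nat.
Qed.

Lemma padic_abs_int_le1 (c : int) : abs c%:~R <= 1.
Proof. by have := padic_abs_int c 0; rewrite expr0 invr1 expn0 dvd1z => ->. Qed.

Lemma padic_abs_unit n : ~~ (p %| n)%N -> abs n%:R = 1.
Proof.
move=> pn; have n0 : n%:Z != 0 by apply: contra pn => /eqP[->]; rewrite dvdn0.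
rewrite -[n%:R]/((n%:Z)%:~R) padic_abs_intE// absz_nat lognE pp.
by rewrite (negbTE pn) andbF.
Qed.

(** The denominator of [w] is prime to [p], hence invertible modulo [p ^ k]. *)
Lemma padic_int_approx w k : abs w <= 1 ->
  exists c : int, abs (w - c%:~R) <= p%:R ^- k.
Proof.
have [->|w0] := eqVneq w 0.
  by exists 0; rewrite subr0 padic_abs0 invr_ge0 exprn_ge0.
move=> w1.
have pd : ~~ (p %| `|denq w|)%N.
  apply/negP => pd; have := coprime_num_den w.
  move: w1; rewrite /padic_abs (negbTE w0) -[1]/(p%:R ^ 0) ler_eXz2l// subr_le0
    lez_nat.
  have ld : (0 < logn p `|denq w|)%N.
    by rewrite -pfactor_dvdn ?absz_gt0 ?denq_eq0// expn1.
  move=> /(leq_trans ld) ln.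
  have pn : (p %| `|numq w|)%N.
    by move: ln; rewrite -pfactor_dvdn ?absz_gt0 ?numq_eq0// expn1.
  rewrite /coprime => /eqP g1; have : (p %| 1)%N by rewrite -g1 dvdn_gcd pn.
  by rewrite dvdn1 => /eqP pE; have := pp; rewrite pE.
have : coprimez (denq w) (p ^ k)%N.
  by rewrite coprimezE absz_nat coprime_sym coprimeXl// prime_coprime.
move=> /coprimezP[[u v] /= uv1]; exists (numq w * u).
have -> : w - (numq w * u)%:~R = w * v%:~R * ((p ^ k)%N%:Z)%:~R.
  have := congr1 (fun z : int => z%:~R : rat) uv1;
    rewrite !rmorphD !rmorphM /= => uv.
  rewrite numqE; transitivity (w * (1 - u%:~R * (denq w)%:~R)); first by ring.
  have -> : 1 - u%:~R * (denq w)%:~R = v%:~R * (p ^ k)%N%:~R :> rat.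
    by apply/eqP; rewrite subr_eq addrC uv.
  by rewrite mulrA.
rewrite !padic_absM -[leRHS]mul1r; apply: ler_pM;
  rewrite ?mulr_ge0 ?padic_abs_ge0//.
  by rewrite -[1]mul1r; apply: ler_pM;
    rewrite ?padic_abs_ge0// padic_abs_int_le1.
by rewrite padic_abs_int dvdzz.
Qed.

Lemma padic_small (e : rat) : 0 < e -> exists k, p%:R ^- k < e.
Proof.
move=> e0; exists (Num.truncn e^-1).+1.
have lt1 : e^-1 < (Num.truncn e^-1).+1%:R by exact: truncnS_gt.
set k := (Num.truncn _).+1 in lt1 *.
rewrite -[ltRHS]invrK ltf_pV2 ?posrE ?invr_gt0 ?exprn_gt0// ?(lt_trans _ p1)//.
apply: lt_trans lt1 _; rewrite -natrX ltr_nat.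
exact: ltn_expl (prime_gt1 pp).
Qed.

End PadicAbs.

Section PadicNumbers.
Variable p : prime_nat.
Local Notation abs := (padic_abs (sval p)).
Local Notation q := (sval p).
Let pp : prime q. Proof. exact: valP p. Qed.
Let eps_gt0 k : 0 < q%:R ^- k :> rat.
Proof. by rewrite invr_gt0 exprn_gt0// ltr0n prime_gt0. Qed.

Lemma Qp_near0 (W : set (Qp p)) : nbhs (0 : Qp p) W <->
  exists k, forall w : cauchy_seq p,
    (\forall n \near \oo, abs (w n) <= q%:R ^- k) ->
      W (gproj (@padic_null p) w).
Proof.
rewrite -[0 : Qp p](gproj0 (@padic_null p)); split.
  move=> /gproj_near; rewrite nbhsE => -[V [oV V0] VW].
  move: oV; rewrite cauchy_seq_openE => /(_ _ V0)[e e0 eV].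
  have [k ke] := padic_small pp e0; exists k => w wk.
  apply/VW/eV; apply: filterS wk => n; rewrite cauchy_seq0 sub0r padic_absN =>
    wk.
  exact: le_lt_trans wk ke.
move=> [k kW]; apply/gproj_near;
  apply: filterS (padic_ball_near 0 (eps_gt0 k)) => w wk.
apply: kW; apply: filterS wk => n; rewrite cauchy_seq0 sub0r padic_absN.
exact: ltW.
Qed.

(** A compatible system of residues modulo the powers of [p], given by
    integer representatives: this presents p-adic integers as an inverse
    limit. *)
Definition coherent (c : nat -> int) : Prop :=
  forall k n, (k <= n)%N -> ((q ^ k)%N%:Z %| c n - c k)%Z.

Lemma coherent_abs c k n : coherent c -> (k <= n)%N ->
  abs ((c n)%:~R - (c k)%:~R) <= q%:R ^- k.
Proof. by move=> cc kn; rewrite -rmorphB /= padic_abs_int//; exact: cc. Qed.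

Lemma coherent_cauchy c : coherent c ->
  (fun n => (c n)%:~R) \in @padic_cauchy p.
Proof.
move=> cc; apply/asboolP => e e0; have [k ke] := padic_small pp e0.
exists k => m n km kn; apply: le_lt_trans ke.
rewrite (_ : _ - _ = ((c m)%:~R - (c k)%:~R) - ((c n)%:~R - (c k)%:~R));
  last by ring.
by apply: padic_absB_le => //; exact: coherent_abs.
Qed.

Definition int_limit c (cc : coherent c) : Qp p :=
  gproj (@padic_null p) (CauchySeq (coherent_cauchy cc)).

Lemma int_limit_Zp c (cc : coherent c) : int_limit cc \in @Zp_pred p.
Proof.
apply/asboolP; exists (CauchySeq (coherent_cauchy cc)) => //.
by apply: nearW => n; exact: padic_abs_int_le1.
Qed.

Lemma padic_null_small (w : cauchy_seq p) :
  (forall k, \forall n \near \oo, abs (w n) <= q%:R ^- k) ->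
    w \in @padic_null p.
Proof.
move=> wk; apply/asboolP => e e0; have [k ke] := padic_small pp e0.
by apply: filterS (wk k) => n wn; exact: le_lt_trans ke.
Qed.

Lemma int_limitB c d e (cc : coherent c) (cd : coherent d) (ce : coherent e) :
  (forall k, ((q ^ k)%N%:Z %| c k - d k - e k)%Z) ->
  int_limit cc - int_limit cd = int_limit ce.
Proof.
move=> cde; rewrite /int_limit -gprojB; apply/gproj_eq/padic_null_small => k.
exists k => // n kn; rewrite !cauchy_seqB /=.
rewrite -!rmorphB /= padic_abs_int//.
apply: dvdz_trans (cde n).
by rewrite dvdzE !absz_nat dvdn_exp2l.
Qed.

Lemma int_limit_eq c d (cc : coherent c) (cd : coherent d) :
  (forall k, ((q ^ k)%N%:Z %| c k - d k)%Z) -> int_limit cc = int_limit cd.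
Proof.
move=> cde; have c0 : coherent (fun=> 0) by move=> k n _; rewrite subrr dvdz0.
have z0 : int_limit c0 = 0.
  rewrite -(subrr (int_limit c0)); apply/esym/int_limitB => k.
  by rewrite !subr0 dvdz0.
rewrite -[RHS]subr0 -z0; apply/esym/int_limitB => k.
by rewrite subr0 -opprB rpredN.
Qed.

(** This and the next lemma say that the classes of the systems vanishing
    modulo [p ^ k] form a basis of neighbourhoods of 0 among the p-adic
    integers. *)
Lemma int_limit_near0 (W : set (Qp p)) : nbhs (0 : Qp p) W ->
  exists k, forall c (cc : coherent c),
    ((q ^ k)%N%:Z %| c k)%Z -> W (int_limit cc).
Proof.
move=> /Qp_near0[k kW]; exists k => c cc ck; apply: kW.
exists k => // n /= kn; rewrite padic_abs_int// -[c n](subrK (c k)).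
by rewrite rpredD// cc.
Qed.

Lemma int_limit_divides k : exists2 W : set (Qp p), nbhs (0 : Qp p) W &
  forall c (cc : coherent c), W (int_limit cc) -> ((q ^ k)%N%:Z %| c k)%Z.
Proof.
exists [set z | exists2 w, gproj (@padic_null p) w = z &
    \forall n \near \oo, abs (w n) <= q%:R ^- k].
  by apply/Qp_near0; exists k => w wk; exists w.
move=> c cc [w /gproj_eq/asboolP wc wk].
have [n [kn wn wcn]] : exists n, [/\ (k <= n)%N, abs (w n) <= q%:R ^- k &
    abs (w n - (c n)%:~R) <= q%:R ^- k].
  near \oo => n; exists n; split.
  - by near: n; exact: nbhs_infty_ge.
  - by near: n.
  - by apply: ltW; near: n; exact: (wc _ (eps_gt0 k)).
have -> : c k = c n - (c n - c k) by ring.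
rewrite rpredB ?cc// -padic_abs_int//.
have -> : (c n)%:~R = w n - (w n - (c n)%:~R) by ring.
exact: padic_absB_le.
Unshelve. all: by end_near. Qed.

(** A Cauchy sequence of norm at most 1 is eventually within [p ^- k] of an
    integer, for every [k]; these integers form a coherent system. *)
Lemma Zp_int_limit z : z \in @Zp_pred p ->
  exists c (cc : coherent c), z = int_limit cc.
Proof.
move=> /asboolP[w <- w1]; have /asboolP cw := cauchy_valP w.
have ex k : exists c : int, \forall n \near \oo, abs (w n - c%:~R) <= q%:R ^- k.
  have [N wN] := cw _ (eps_gt0 k); case: w1 => M _ wM.
  have [c wc] := padic_int_approx pp k (wM (maxn M N) (leq_maxl _ _)).
  exists c, N => // n /= Nn.
  rewrite (_ : _ - _ = (w n - w (maxn M N)) - (c%:~R - w (maxn M N))); last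
    by ring.
  apply: padic_absB_le => //; last by rewrite -padic_absN opprB.
  by apply: ltW; apply: wN => //; exact: leq_maxr.
pose c k := sval (cid (ex k)).
have cP k : \forall n \near \oo, abs (w n - (c k)%:~R) <= q%:R ^- k.
  exact: svalP (cid (ex k)).
have cc : coherent c.
  move=> k n kn; rewrite -padic_abs_int// rmorphB /=.
  near \oo => m.
  rewrite (_ : _ - _ = (w m - (c k)%:~R) - (w m - (c n)%:~R)); last by ring.
  apply: padic_absB_le => //; first by near: m; exact: cP.
  apply: (@le_trans _ _ (q%:R ^- n)); first by near: m; exact: cP.
  rewrite lef_pV2 ?posrE ?exprn_gt0 ?ltr0n ?prime_gt0//.
  by rewrite ler_weXn2l// ler1n prime_gt0.
exists c, cc; apply/gproj_eq/padic_null_small => k.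
near=> n; rewrite cauchy_seqB /=.
rewrite (_ : _ - _ = (w n - (c k)%:~R) - ((c n)%:~R - (c k)%:~R)); last by ring.
apply: padic_absB_le => //; first by near: n; exact: cP.
by apply: coherent_abs => //; near: n; exact: nbhs_infty_ge.
Unshelve. all: by end_near. Qed.

(** The second part records that integers prime to [p] are units of the
    p-adic integers; the restricted product is divisible because of it. *)
Lemma Qp_divisible n (z : Qp p) : (0 < n)%N ->
  exists y : Qp p, y *+ n = z /\
  (z \in @Zp_pred p -> ~~ (q %| n)%N -> y \in @Zp_pred p).
Proof.
move=> n0; have [w wz] := gproj_surj z.
have nQ : n%:R != 0 :> rat by rewrite pnatr_eq0 -lt0n.
have an0 : 0 < abs n%:R^-1.
  rewrite lt_neqAle padic_abs_ge0 andbT eq_sym /padic_abs invr_eq0 (negbTE nQ).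
  by rewrite expfz_neq0// pnatr_eq0 -lt0n prime_gt0.
have divP (v : cauchy_seq p) : (fun k => v k / n%:R) \in @padic_cauchy p.
  apply/asboolP => e e0; have /asboolP cv := cauchy_valP v.
  have [N NP] := cv _ (divr_gt0 e0 an0); exists N => k l Nk Nl.
  by rewrite -mulrBl padic_absM// -ltr_pdivlMr//; exact: NP.
have divE (v : cauchy_seq p) : gproj (@padic_null p) (CauchySeq (divP v)) *+ n
  = gproj _ v.
  rewrite -gprojMn; congr (gproj _ _); apply/val_inj/funext => k /=.
  have E (u : cauchy_seq p) m : (u *+ m : cauchy_seq p) k = u k *+ m.
    elim: m => [//|m IH]; rewrite !mulrS -IH.
    by rewrite -{1}[u]opprK addrC cauchy_seqB -[(- u) k]/(- u k) opprK addrC.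
  by rewrite E /= -[LHS]mulr_natr divfK.
have [/asboolP[v vz v1]|nZ] := boolP (z \in @Zp_pred p); last first.
  by exists (gproj _ (CauchySeq (divP w))); rewrite divE.
exists (gproj _ (CauchySeq (divP v))); split; first by rewrite divE.
move=> _ qn; apply/asboolP; exists (CauchySeq (divP v)) => //.
apply: filterS v1 => k vk /=; rewrite padic_absM//.
have -> : abs n%:R^-1 = 1; last by rewrite mulr1.
have : abs n%:R^-1 * abs n%:R = 1.
  by rewrite -padic_absM// mulVf// -[1]/(1%:R) padic_abs_unit// dvdn1 neq_ltn
    prime_gt1 ?orbT.
by rewrite (padic_abs_unit pp qn) mulr1.
Qed.

Lemma Qp_torsion_Zp (z : Qp p) : exists2 n, (0 < n)%N & z *+ n \in @Zp_pred p.
Proof.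
have [w <-] := gproj_surj z; have /asboolP cw := cauchy_valP w.
have [N NP] := cw _ ltr01.
exists `|denq (w N)|%N; first by rewrite absz_gt0 denq_eq0.
rewrite -gprojMn; apply/asboolP; exists (w *+ `|denq (w N)|) => //.
exists N => // k /= Nk.
have -> m : (w *+ m : cauchy_seq p) k = w k *+ m.
  elim: m => [//|m IH]; rewrite !mulrS -IH.
  by rewrite -{1}[w]opprK addrC cauchy_seqB -[(- w) k]/(- w k) opprK addrC.
set d := `|_|%N.
have dE : d%:R = (denq (w N))%:~R :> rat
  by rewrite -[d%:R]/((d%:Z)%:~R) /d absz_denq.
rewrite -[w k *+ d]mulr_natr.
rewrite (_ : _ * _ = (w k - w N) * d%:R - (- (numq (w N))%:~R)).
  apply: padic_absB_le => //; last by rewrite padic_absN padic_abs_int_le1.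
  rewrite padic_absM// -[1]mul1r; apply: ler_pM; rewrite ?padic_abs_ge0//.
    by apply/ltW/NP.
  by rewrite dE padic_abs_int_le1.
by rewrite numqE dE; ring.
Qed.

End PadicNumbers.

(** * Coordinates on a compact torsion-free group *)

Lemma near_seq (X : Type) (F : set_system X) (I : eqType) (s : seq I)
    (P : I -> set X) : Filter F -> (forall i, F (P i)) ->
  F [set x | forall i, i \in s -> P i x].
Proof.
move=> FF FP; elim: s => [|i s IH]; first by apply: filterS filterT.
apply: filterS (filterI (FP i) IH) => x [Pix Psx] j.
by rewrite inE => /predU1P[->|/Psx].
Qed.

Lemma zmod_cancel (G : zmodType) (u X v W Y : G) :
  u - (X + v) + (Y + W) + (X - Y) = u - (v - W).
Proof.
rewrite opprD -!addrA; congr (u + _).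
rewrite [W + _]addrCA [Y + _]addrCA [Y + (W - Y)]addrC subrK.
by rewrite [- v + _]addrCA addKr opprB addrC.
Qed.

Lemma zmod_cancel_sub (G : zmodType) (u v a b c : G) :
  u - v - c - (u - a - (v - b)) = a - b - c.
Proof.
have -> : u - a - (v - b) = u - v - (a - b).
  by rewrite !opprB [b - v]addrC addrACA [- a + b]addrC.
by rewrite opprD addrACA subrr add0r opprK addrC.
Qed.

Lemma rprod_ext (r : prime_nat -> nat)
    (z w : rprod (fun p : prime_nat => Zp_pow p (r p))) :
  (forall p i, rprod_val z p i = rprod_val w p i) -> z = w.
Proof.
move=> zw; apply: val_inj; apply: functional_extensionality_dep => p.
by apply: functional_extensionality_dep => i; exact: zw.
Qed.

Lemma finite_prime_divisors n : (0 < n)%N ->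
  finite_set [set p : prime_nat | (sval p %| n)%N].
Proof.
move=> n0; pose v : prime_nat -> nat := sval.
apply: (@sub_finite_set _ _ (v @^-1` `I_n.+1)).
  by move=> p /= /(dvdn_leq n0).
by apply: finite_preimage => // p q _ _; exact: val_inj.
Qed.

Section IntegerCombinations.
Variables (T : zmodType) (r : nat) (x : 'I_r -> T).

Definition int_comb (c : 'I_r -> int) : T := \sum_i x i *~ c i.

Lemma int_combB c d : int_comb (fun i => c i - d i) = int_comb c - int_comb d.
Proof.
by rewrite /int_comb -sumrB; apply: eq_bigr => i _; rewrite mulrzBr.
Qed.

Lemma int_combZ c m : int_comb (fun i => c i * m) = int_comb c *~ m.
Proof.
by rewrite /int_comb mulrz_suml; apply: eq_bigr => i _; rewrite mulrzA.
Qed.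

End IntegerCombinations.

Section ProfiniteCoordinates.
Variables (T : topologicalZmodType) (U : set T).
Hypotheses (sU : subgrp U) (U0 : nbhs 0 U) (cU : compact U).
Hypotheses (mulT : forall n, (0 < n)%N -> mul_open T n).
Hypotheses (tfT : torsionfree T) (hT : hausdorff_space T).
Hypothesis unifU : forall W : set T, nbhs 0 W ->
  exists2 n, (0 < n)%N & forall u, U u -> W (u *+ n).

Definition multiples n : set T := [set u *+ n | u in U].
Local Notation mulU := multiples.

Lemma multiples_subgrp n : subgrp (mulU n).
Proof.
split; first by exists 0; [exact: (subgrp0 sU)|rewrite mul0rn].
move=> _ _ [u Uu <-] [v Uv <-]; exists (u - v); first exact: subgrpB.
by rewrite mulrnBl.
Qed.

Lemma multiples_near0 n : (0 < n)%N -> nbhs 0 (mulU n).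
Proof. by move=> n0; exact: mulT. Qed.

Lemma multiples_closed n : (0 < n)%N -> closed (mulU n).
Proof.
by move=> n0; apply: subgrp_closed;
  [exact: multiples_subgrp|exact: multiples_near0].
Qed.

Lemma multiples_sub n : mulU n `<=` U.
Proof. by move=> _ [u Uu <-]; exact: subgrpMn. Qed.

Lemma multiples_dvdn m n : (m %| n)%N -> mulU n `<=` mulU m.
Proof.
move=> /dvdnP[k ->] _ [u Uu <-]; exists (u *+ k); first exact: subgrpMn.
by rewrite -mulrnA.
Qed.

Lemma multiples_int n (k : int) u : U u -> (n%:Z %| k)%Z -> mulU n (u *~ k).
Proof.
move=> Uu /dvdzP[m ->]; exists (u *~ m); first exact: subgrpMz.
by rewrite pmulrn -mulrzA.
Qed.

Lemma multiples_coprime m n x : coprime m n -> mulU m x -> mulU n x ->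
  mulU (m * n) x.
Proof.
rewrite -[coprime m n]/(coprimez m n) => /coprimezP[[a b] /= ab1].
move=> [u Uu ux] [v Uv vx]; exists (v *~ a + u *~ b).
  by apply: subgrpD => //; exact: subgrpMz.
rewrite -[RHS](mulr1z x) -ab1 mulrzDr -{1}vx -ux mulrnDl !pmulrn -!mulrzA PoszM.
by congr (_ *~ _ + _ *~ _); ring.
Qed.

(** One prime is split off at a time, the coprime case being Bezout. *)
Lemma multiples_primes n x : (0 < n)%N -> U x ->
  (forall p, prime p -> mulU (p ^ logn p n) x) -> mulU n x.
Proof.
move=> + Ux; elim/ltn_ind: n => n IH n0 nx.
have [n1|n1] := leqP n 1.
  have -> : n = 1%N by apply/eqP; rewrite eqn_leq n1.
  by exists x.
set p := pdiv n; have pp : prime p := pdiv_prime n1.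
have [m pm nE] := pfactor_coprime pp n0.
have m0 : (0 < m)%N by move: n0; rewrite nE muln_gt0 => /andP[].
have l0 : (0 < logn p n)%N by rewrite logn_gt0 mem_primes pp n0 pdiv_dvd.
rewrite nE; apply: multiples_coprime; last exact: nx.
  by rewrite coprime_sym coprimeXl.
apply: IH => // [|r pr].
  by rewrite nE -{1}[m]muln1 ltn_pmul2l// -(expn0 p) ltn_exp2l ?prime_gt1.
apply: multiples_dvdn (nx r pr); rewrite dvdn_exp2l//.
by rewrite nE lognM ?expn_gt0 ?(prime_gt0 pp)// leq_addr.
Qed.

Section Combinations.
Variables (r : nat) (x : 'I_r -> T).

Hypothesis xU : forall i, U (x i).

Lemma int_comb_in c : U (int_comb x c).
Proof. by apply: (subgrp_sum sU) => i; exact: subgrpMz. Qed.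

Lemma int_comb_dvd n c : (forall i, (n%:Z %| c i)%Z) -> mulU n (int_comb x c).
Proof.
move=> nc; apply: (subgrp_sum (multiples_subgrp n)) => i.
exact: multiples_int.
Qed.

End Combinations.

Section OnePrime.
Variable p : nat.
Hypothesis pp : prime p.

Definition generates_mod r (x : 'I_r -> T) : Prop := (forall i, U (x i)) /\
  forall u, U u -> exists c, mulU p (u - int_comb x c).

(** [pU] is open in the compact group [U], so it has finite index. *)
Lemma finitely_generated_mod : exists r (x : 'I_r -> T), generates_mod x.
Proof.
have [s sP] := compact_seq_cover cU (f := fun y => [set x | mulU p (x - y)])
  (fun x _ => nbhs_subr x (multiples_near0 (prime_gt0 pp))).
pose t := [seq y <- s | `[< U y >]].
have tU y : y \in t -> U y by rewrite mem_filter => /andP[/asboolP].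
exists (size t), (fun i => nth 0 t i); split; first by move=> i;
  apply/tU/mem_nth.
move=> u Uu; have [y ys uy] := sP u Uu.
have yt : y \in t.
  rewrite mem_filter ys andbT; apply/asboolP.
  by rewrite -(subKr u y); apply: (subgrpB sU) => //; exact: multiples_sub uy.
have it : (index y t < size t)%N by rewrite index_mem.
exists (fun i => (i == Ordinal it)%:Z).
rewrite /int_comb (bigD1 (Ordinal it))//= eqxx nth_index// big1 ?addr0//.
by move=> i /negbTE ->.
Qed.

(** A generating family of minimal size: from a relation with a coefficient
    [c j] prime to [p] one could express [x j] by the others modulo [pU]. *)
Lemma independent_generators : exists r (x : 'I_r -> T), generates_mod x /\
  forall c, mulU p (int_comb x c) -> forall i, (p%:Z %| c i)%Z.
Proof.
have ex : exists r, `[< exists x : 'I_r -> T, generates_mod x >].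
  by have [r [x xg]] := finitely_generated_mod; exists r; apply/asboolP;
    exists x.
case: (ex_minnP ex) => r /asboolP[x [xU xg]] rmin; exists r, x; split=> //.
move=> c cp j; apply: contrapT => /negP pcj.
case: r x xU xg rmin c cp j pcj => [|r] x xU xg rmin c cp j pcj; first
  by case: j pcj.
suff : (r.+1 <= r)%N by rewrite ltnn.
apply: rmin; apply/asboolP; exists (fun i => x (lift j i)); split=> // u Uu.
have [d dP] := xg u Uu.
have : coprimez (c j) p by rewrite coprimez_sym coprimezE prime_coprime.
move=> /coprimezP[[a b] /= ab1].
exists (fun i => d (lift j i) - d j * a * c (lift j i)).
(* As [a * c j + b * p = 1], the term in [x j] is traded for the relation [cp]
   multiplied by [d j * a], up to an element of [pU]. *)
have dx : mulU p (x j *~ (d j * b * p%:Z)) by apply: multiples_int => //;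
  exact: dvdz_mull.
have sp := multiples_subgrp p.
have := subgrpD sp (subgrpD sp dP (subgrpMz sp (d j * a) cp)) dx.
have -> : x j *~ (d j * b * p%:Z) = x j *~ d j - x j *~ (c j * (d j * a)).
  by rewrite -mulrzBr; congr (_ *~ _); rewrite -{2}[d j]mulr1 -ab1; ring.
congr (mulU p _); rewrite /int_comb !(bigD1_ord j)//= mulrzDl -mulrzA.
set Y := x j *~ (_ * _); set v := \sum_(i < r) x _ *~ d _.
have -> : \sum_(i < r) x (lift j i) *~ (d (lift j i) - d j * a * c (lift j i)) =
    v - (\sum_(i < r) x (lift j i) *~ c (lift j i)) *~ (d j * a).
  rewrite mulrz_suml -sumrB; apply: eq_bigr => i _.
  by rewrite mulrzBr -mulrzA [c _ * _]mulrC.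
exact: zmod_cancel.
Qed.

Variables (r : nat) (x : 'I_r -> T).
Hypothesis xgen : generates_mod x.
Hypothesis xind : forall c, mulU p (int_comb x c) -> forall i, (p%:Z %| c i)%Z.

Let xU : forall i, U (x i). Proof. exact: xgen.1. Qed.

(** By induction, applying the case [k = 1] to the quotient by [p] of the
    error. *)
Lemma digits_exist k u : U u -> exists c, mulU (p ^ k) (u - int_comb x c).
Proof.
elim: k u => [|k IH] u Uu.
  by exists (fun=> 0); exists (u - int_comb x (fun=> 0)) => //;
    apply/(subgrpB sU)/int_comb_in.
have [c [v Vv vc]] := xgen.2 u Uu; have [d [w Uw wd]] := IH v Vv.
exists (fun i => c i - d i * - p%:Z); exists w => //.
rewrite int_combB int_combZ mulrNz opprK opprD addrA -vc -pmulrn -mulrnBl -wd.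
by rewrite -mulrnA expnSr.
Qed.

(** The coefficients are divisible by [p] by independence modulo [pU]. As [T]
    is torsion-free one can divide the relation by [p] and use induction. *)
Lemma digits_unique k c : mulU (p ^ k) (int_comb x c) ->
  forall i, ((p ^ k)%N%:Z %| c i)%Z.
Proof.
elim: k c => [|k IH] c; first by move=> _ i; rewrite expn0 dvd1z.
move=> ck i; have pc := xind (multiples_dvdn (dvdn_exp _ (dvdnn p)) ck).
pose d i := (c i %/ p)%Z; have cE j : c j = d j * p by rewrite divzK ?pc.
have [v Uv vE] := ck.
have : int_comb x d - v *+ p ^ k = 0.
  apply: (tfT (prime_gt0 pp)); rewrite mulrnBl -mulrnA -expnSr vE.
  by rewrite pmulrn -int_combZ; apply/eqP; rewrite subr_eq0; apply/eqP;
    apply: eq_bigr => j _; rewrite cE.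
move=> /eqP; rewrite subr_eq0 => /eqP dv.
by rewrite cE expnSr PoszM dvdz_mul// IH//; exists v.
Qed.

End OnePrime.

(** The congruences are imposed for one prime [m] at a time, by adding a
    multiple of [(m.-1)`! ^ k], which is prime to [m] and divisible by
    [p ^ k] for the previous primes [p]. *)
Lemma chinese (k m : nat) (t : prime_nat -> T) : (forall p, U (t p)) ->
  exists2 u, U u & forall p : prime_nat, (sval p < m)%N ->
    mulU (sval p ^ k) (u - t p).
Proof.
move=> tU; elim: m => [|m [u Uu uP]]; first by exists 0; [exact: (subgrp0 sU)|].
have [pm|npm] := boolP (prime m); last first.
  exists u => // p; rewrite ltnS leq_eqVlt => /predU1P[pm|/uP//].
  by move: npm; rewrite -pm (valP p).
pose P : prime_nat := exist _ m pm.
have cop : coprime (m.-1)`! m.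
  rewrite coprime_sym; have : (m.-1 < m)%N by rewrite prednK ?prime_gt0.
  elim: m.-1 => [|n IH] nm; first by rewrite fact0 coprimen1.
  by rewrite factS coprimeMr IH 1?ltnW// andbT prime_coprime// gtnNdvd.
have : coprimez (m.-1`! ^ k)%N (m ^ k)%N
  by rewrite coprimezE !absz_nat coprimeXl// coprimeXr.
move=> /coprimezP[[a b] /= ab1].
exists (u + (t P - u) *~ (a * (m.-1`! ^ k)%N%:Z)).
  by apply: (subgrpD sU) => //; apply: (subgrpMz sU); exact: (subgrpB sU).
have tu : U (t P - u) by exact: (subgrpB sU).
move=> p; rewrite ltnS leq_eqVlt => /predU1P[pE|pm'].
  have -> : p = P by apply: val_inj.
  have -> : u + (t P - u) *~ (a * (m.-1`! ^ k)%N%:Z) - t P =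
      (t P - u) *~ (- (b * (m ^ k)%N%:Z)).
    have -> : - (b * (m ^ k)%N%:Z) = a * (m.-1`! ^ k)%N%:Z - 1 by rewrite -ab1;
      ring.
    by rewrite mulrzBr mulr1z opprB [u + _]addrC -addrA.
  by apply: multiples_int => //; rewrite rpredN dvdz_mull.
rewrite addrAC; apply: (subgrpD (multiples_subgrp _)); first exact: uP.
apply: multiples_int => //; apply: dvdz_mull;
  rewrite dvdzE !absz_nat dvdn_exp2r//.
by rewrite dvdn_fact// prime_gt0 ?(valP p)//= -ltnS prednK ?prime_gt0.
Qed.

Lemma all_multiples_eq0 u : U u ->
  (forall (p : prime_nat) k, mulU (sval p ^ k) u) -> u = 0.
Proof.
move=> Uu uP; apply: contrapT => /eqP /(hausdorff_separates0 hT)[W W0]; apply.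
have [n n0 nW] := unifU W0.
have [v Uv <-] : mulU n u; last exact: nW.
apply: multiples_primes => // p pp; exact: (uP (exist _ p pp)).
Qed.

Lemma coordinates_exist :
  exists (r : prime_nat -> nat) (x : forall p, 'I_(r p) -> T),
  forall p, generates_mod (sval p) (x p) /\
  forall c, mulU (sval p) (int_comb (x p) c) ->
    forall i, ((sval p)%:Z %| c i)%Z.
Proof.
have ex (p : prime_nat) := independent_generators (valP p).
exists (fun p => sval (cid (ex p))).
exists (fun p => sval (cid (svalP (cid (ex p))))) => p.
exact: svalP (cid (svalP (cid (ex p)))).
Qed.

Section Coordinates.
Variables (r : prime_nat -> nat) (x : forall p, 'I_(r p) -> T).
Arguments x : clear implicits.
Hypothesis xgen : forall p : prime_nat, generates_mod (sval p) (x p).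
Hypothesis xind : forall (p : prime_nat) c, mulU (sval p) (int_comb (x p) c) ->
  forall i, ((sval p)%:Z %| c i)%Z.

Let xU p i : U (x p i). Proof. exact: (xgen p).1. Qed.

(** Outside of [U] the coordinates are those of 0; this only serves to have a
    total function. *)
Let inU u : T := if `[< U u >] then u else 0.
Let inU_U u : U (inU u).
Proof. by rewrite /inU; case: asboolP => // _; exact: (subgrp0 sU). Qed.
Let inU_id u : U u -> inU u = u.
Proof. by rewrite /inU; case: asboolP. Qed.

Definition digit (p : prime_nat) u k : 'I_(r p) -> int :=
  sval (cid (digits_exist (xgen p) k (inU_U u))).

Arguments digit : clear implicits.

Lemma digitP (p : prime_nat) u k : U u ->
  mulU (sval p ^ k) (u - int_comb (x p) (digit p u k)).
Proof.
move=> Uu; rewrite -{1}(inU_id Uu).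
exact: svalP (cid (digits_exist (xgen p) k (inU_U u))).
Qed.

Let digitP' (p : prime_nat) u k :
  mulU (sval p ^ k) (inU u - int_comb (x p) (digit p u k)).
Proof. exact: svalP (cid (digits_exist (xgen p) k (inU_U u))). Qed.

Let unique p k c := digits_unique (valP p) (@xind p) (k := k) (c := c).

Lemma digit_coherent p u i : coherent p (fun k => digit p u k i).
Proof.
move=> k n kn.
apply: (unique (k := k) (c := fun i => digit p u n i - digit p u k i)).
have sp := multiples_subgrp (sval p ^ k); rewrite int_combB.
have -> : int_comb (x p) (digit p u n) - int_comb (x p) (digit p u k) =
    (inU u - int_comb (x p) (digit p u k)) -
    (inU u - int_comb (x p) (digit p u n)).
  by rewrite opprB [RHS]addrC addrA subrK.
apply: (subgrpB sp); first exact: digitP'.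
by apply: multiples_dvdn (digitP' p u n); rewrite dvdn_exp2l.
Qed.

Local Notation P := (rprod (fun p : prime_nat => Zp_pow p (r p))).

Definition coord_fun u : gprod (fun p : prime_nat => gpow (Qp p) (r p)) :=
  fun p i => int_limit (digit_coherent (p := p) u i).

Arguments coord_fun : clear implicits.

Lemma coord_in u (p : prime_nat) : coord_fun u p \in Zp_pow p (r p).
Proof. by apply/asboolP => i; exact: int_limit_Zp. Qed.

Lemma coord_almost u :
  coord_fun u \in almost_in (fun p : prime_nat => Zp_pow p (r p)).
Proof.
apply/asboolP; apply: (sub_finite_set _ (finite_set0 _)) => p /=.
by rewrite coord_in.
Qed.

Definition coord u : P := RProd (coord_almost u).

Lemma coordE u p i :
  rprod_val (coord u) p i = int_limit (digit_coherent (p := p) u i).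
Proof. by []. Qed.

Lemma coordB u v : U u -> U v -> coord (u - v) = coord u - coord v.
Proof.
move=> Uu Uv; apply: rprod_ext => p i.
rewrite -[RHS]/(rprod_val (coord u) p i - rprod_val (coord v) p i) !coordE.
apply/esym/int_limitB => k.
apply: (unique (c := fun i =>
  digit p u k i - digit p v k i - digit p (u - v) k i)).
have sp := multiples_subgrp (sval p ^ k); rewrite !int_combB.
have := subgrpB sp (digitP p k (subgrpB sU Uu Uv))
  (subgrpB sp (digitP p k Uu) (digitP p k Uv)).
congr (mulU _ _); move: (int_comb _ _) (int_comb _ _) (int_comb _ _) => w cu cv.
exact: zmod_cancel_sub.
Qed.

Lemma digit_multiple (p : prime_nat) u k : mulU (sval p ^ k) u ->
  forall i, ((sval p ^ k)%N%:Z %| digit p u k i)%Z.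
Proof.
move=> uk; apply: (unique (c := digit p u k)).
rewrite -[int_comb _ _](subKr u); apply: (subgrpB (multiples_subgrp _)) => //.
by apply: digitP; exact: multiples_sub uk.
Qed.

Lemma multiple_digit (p : prime_nat) u k : U u ->
  (forall i, ((sval p ^ k)%N%:Z %| digit p u k i)%Z) -> mulU (sval p ^ k) u.
Proof.
move=> Uu uk; rewrite -(subrK (int_comb (x p) (digit p u k)) u).
apply: (subgrpD (multiples_subgrp _)); first exact: digitP.
exact: int_comb_dvd.
Qed.

Lemma coord_eq0 u : U u -> coord u = 0 -> u = 0.
Proof.
move=> Uu u0; apply: all_multiples_eq0 => // p k; apply: multiple_digit => // i.
have [W W0 Wk] := int_limit_divides p k; apply: (Wk _ (digit_coherent (p :=
  p) u i)).
by rewrite -coordE u0; exact: nbhs_singleton.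
Qed.

Lemma coord_near0 (W : set P) : nbhs 0 W -> nbhs 0 [set u | W (coord u)].
Proof.
rewrite nbhsE => -[W' [oW' W'0] W'W]; move: oW'; rewrite rprod_openE =>
  /(_ _ W'0).
move=> [B [[oB /finite_seqP[s sB]] B0 BW']].
have near p : \forall u \near 0, B p (rprod_val (coord u) p).
  have Bp0 : nbhs (0 : gpow (Qp p) (r p)) (B p) by apply: open_nbhs_nbhs;
    split; [exact: oB|exact: (B0 p)].
  suff cv : (fun u => rprod_val (coord u) p) @ nbhs (0 : T) --> (0 : gpow (Qp
    p) (r p)).
    exact: (cv _ Bp0).
  apply/gprod_cvgP => i V /int_limit_near0[k kV].
  apply: (@filterS _ _ _ (mulU (sval p ^ k))).
    by move=> u uk; apply: kV; exact: digit_multiple.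
  by apply: multiples_near0; rewrite expn_gt0 prime_gt0// (valP p).
have : nbhs (0 : T) [set u | forall p, p \in s -> B p (rprod_val (coord u) p)].
  exact: (@near_seq _ _ _ s (fun p : prime_nat =>
    [set u | B p (rprod_val (coord u) p)])).
apply: filterS => u uB; apply/W'W/BW' => p.
have [ps|ps] := boolP (p \in s); first exact: uB.
have -> : B p = [set` Zp_pow p (r p)].
  apply: contrapT => nB; move/negP: ps; apply.
  by have : [set p | B p <> [set` Zp_pow p (r p)]] p by []; rewrite sB.
exact: coord_in.
Qed.

(** For each [n], the conditions imposed by [z] modulo [p ^ n] for the primes
    [p < n] define a non-empty closed subset of [U]; these sets decrease, so
    they have a common point. *)
Lemma coord_surj (z : P) : (forall p, rprod_val z p \in Zp_pow p (r p)) ->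
  exists2 u, U u & coord u = z.
Proof.
move=> zZ.
have ex p i : exists c, exists cc : coherent p c,
  rprod_val z p i = int_limit cc.
  have /asboolP/(_ i) := zZ p; exact: Zp_int_limit.
pose c p i := sval (cid (ex p i)).
have cc p i : coherent p (c p i) by have [] := svalP (cid (ex p i)).
have cE p i : rprod_val z p i = int_limit (cc p i).
  have [cc' ->] := svalP (cid (ex p i)); apply: int_limit_eq => k.
  by rewrite subrr dvdz0.
pose t n p := int_comb (x p) (fun i => c p i n).
have tP p k n : (k <= n)%N -> mulU (sval p ^ k) (t n p - t k p).
  move=> kn; rewrite -int_combB; apply: int_comb_dvd => // i;
    exact: (cc p i k n kn).
have tU n p : U (t n p) by exact: int_comb_in.
pose C n := \bigcap_(p in [set p : prime_nat | (sval p < n)%N])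
  [set u : T | mulU (sval p ^ n) (u - t n p)].
have [||||u Uu uC] := @compact_nested T U C.
- by [].
- move=> n; apply: closed_bigI => p _.
  rewrite (_ : [set u | _] = (fun u => - t n p + u) @^-1` mulU (sval p ^ n)).
    apply: closed_comp => [u _|]; first by move=> W /shift_near.
    by apply: multiples_closed; rewrite expn_gt0 prime_gt0// (valP p).
  by apply/seteqP; split=> u /=; rewrite addrC.
- move=> m n mn u uC p /= pm; have sp := multiples_subgrp (sval p ^ m).
  have -> : u - t m p = (u - t n p) + (t n p - t m p) by rewrite addrA subrK.
  apply: (subgrpD sp); last exact: tP.
  by apply: multiples_dvdn (uC p (leq_trans pm mn)); rewrite dvdn_exp2l.
- by move=> n; have [u Uu uP] := chinese n n (tU n); exists u.
exists u => //; apply: rprod_ext => p i; rewrite coordE cE;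
  apply: int_limit_eq => k.
apply: (unique (c := fun i => digit p u k i - c p i k)).
have sp := multiples_subgrp (sval p ^ k); rewrite int_combB.
(* [C n] gives information at [p] only when [p < n]. *)
pose n := maxn k (sval p).+1.
have -> : int_comb (x p) (digit p u k) - int_comb (x p) (fun i => c p i k) =
    (u - t n p) + (t n p - t k p) - (u - int_comb (x p) (digit p u k)).
  by rewrite addrA subrK opprB [RHS]addrC addrA subrK.
apply: (subgrpB sp); last exact: digitP.
apply: (subgrpD sp); last by apply: tP; exact: leq_maxl.
have := uC n p (leq_maxr _ _); apply: multiples_dvdn.
by rewrite dvdn_exp2l// leq_maxl.
Qed.

(** It is enough to find a neighbourhood of 0 in the image of [nU]. If the
    coordinates at the finitely many primes [p] dividing [n] vanish modulo
    the [p]-part of [n], then [u] is divisible in [U] by each of these parts,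
    hence by [n]. *)
Lemma coord_open (V : set T) : nbhs 0 V -> nbhs 0 [set coord u | u in U `&` V].
Proof.
move=> /unifU[n n0 nV].
have ex (p : prime_nat) : exists B : set (gpow (Qp p) (r p)),
    [/\ open B, B 0, B `<=` [set` Zp_pow p (r p)] &
      if (sval p %| n)%N then forall u, B (rprod_val (coord u) p) -> forall i,
        ((sval p ^ logn (sval p) n)%N%:Z %| digit p u (logn (sval p) n) i)%Z
      else B = [set` Zp_pow p (r p)]].
  have Zp0 : [set` Zp_pow p (r p)] (0 : gpow (Qp p) (r p)) by exact: rpred0.
  case: (sval p %| n)%N; last by exists [set` Zp_pow p (r p)]; split=> //;
    exact: open_subgroupP.
  have [W W0 Wk] := int_limit_divides p (logn (sval p) n).
  have nB : nbhs (0 : gpow (Qp p) (r p)) [set y : gpow (Qp p) (r p) | forall i,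
    W (y i)].
    apply: (@filter_forall _ _ (fun i =>
      [set y : gpow (Qp p) (r p) | W (y i)]) (nbhs 0) _) => i.
    exact: (@gprod_proj_near _ (fun=> Qp p) 0 i W).
  exists ([set y : gpow (Qp p) (r p) | forall i,
    W (y i)]° `&` [set` Zp_pow p (r p)]); split.
  - by apply: openI; [exact: open_interior|exact: open_subgroupP].
  - by split=> //; exact: nB.
  - by move=> y [].
  - move=> u [/interior_subset uW _] i.
    exact: (Wk _ (digit_coherent (p := p) u i) (uW i)).
pose B p := sval (cid (ex p)).
have BP p := svalP (cid (ex p)).
have oB : open (rbox B : set P).
  apply: rbox_open; split; first by move=> p; have [] := BP p.
  apply: sub_finite_set (finite_prime_divisors n0) => p /=.
  by have [_ _ _] := BP p; case: ifP.
have : nbhs (0 : P) (rbox B).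
  by apply: open_nbhs_nbhs; split=> // p; have [] := BP p.
apply: filterS => z zB.
have [|u Uu uz] := coord_surj (z := z).
  by move=> p; have [_ _ + _] := BP p; apply; exact: zB.
exists u => //; split=> //; have [v Uv <-] : mulU n u; last exact: nV.
apply: multiples_primes => // q pq; pose p : prime_nat := exist _ q pq.
have [_ _ _] := BP p; case: ifP => [_ Bu|/= qn _]; last first.
  suff -> : logn q n = 0%N by exists u.
  by rewrite lognE pq n0 qn.
by apply: (@multiple_digit p) => //; apply: Bu; rewrite uz; exact: zB.
Qed.

End Coordinates.

Lemma profinite_coordinates : exists (r : prime_nat -> nat)
    (phi : T -> rprod (fun p : prime_nat => Zp_pow p (r p))),
  [/\ forall u v, U u -> U v -> phi (u - v) = phi u - phi v,
      forall u, U u -> phi u = 0 -> u = 0,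
      forall W, nbhs 0 W -> nbhs 0 [set u | W (phi u)],
      forall V, nbhs 0 V -> nbhs 0 [set phi u | u in U `&` V] &
      forall z : rprod (fun p : prime_nat => Zp_pow p (r p)),
        (forall p, rprod_val z p \in Zp_pow p (r p)) ->
        exists2 u, U u & phi u = z].
Proof.
have [r [x xP]] := coordinates_exist.
have xg p := (xP p).1; have xi p := (xP p).2.
exists r, (coord xg xi); split.
- exact: coordB.
- exact: coord_eq0.
- exact: coord_near0.
- exact: coord_open.
- exact: coord_surj.
Qed.

End ProfiniteCoordinates.

(** * Restricted products and the rank of a quotient *)

Lemma common_multiple (I : eqType) (s : seq I) (Q : I -> nat -> Prop) :
  (forall i, i \in s -> exists2 n, (0 < n)%N & Q i n) ->
  (forall i m n, Q i m -> (m %| n)%N -> Q i n) ->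
  exists2 n, (0 < n)%N & forall i, i \in s -> Q i n.
Proof.
move=> + Qd; elim: s => [|i s IH] sQ; first by exists 1%N.
have [m m0 Qm] := sQ i (mem_head i s).
have [j js|n n0 Qn] := IH; first by apply: sQ; rewrite inE js orbT.
exists (m * n)%N; first by rewrite muln_gt0 m0.
move=> j; rewrite inE => /predU1P[->|/Qn Qj];
  first exact: Qd Qm (dvdn_mulr _ _).
exact: Qd Qj (dvdn_mull _ _).
Qed.


Lemma dsumMn (A B : topologicalZmodType) (x : dsum A B) n :
  x *+ n = (x.1 *+ n, x.2 *+ n) :> dsum A B.
Proof. by elim: n => [//|n IH]; rewrite !mulrS IH. Qed.

Lemma dsum_divisible (A B : topologicalZmodType) :
  divisible A -> divisible B -> divisible (dsum A B).
Proof.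
move=> dA dB n n0 [a b]; have [a' aa'] := dA n n0 a; have [b' bb'] := dB n n0 b.
by exists (a', b'); rewrite dsumMn /= aa' bb'.
Qed.

Lemma dsum_near0 (A B : topologicalZmodType) (W : set (dsum A B)) :
  nbhs 0 W <-> exists P Q, [/\ nbhs 0 P, nbhs 0 Q & P `*` Q `<=` W].
Proof.
split; first by move=> [[P Q] [/= P0 Q0] PQ]; exists P, Q.
by move=> [P [Q [P0 Q0 PQ]]]; exists (P, Q).
Qed.

Section RestrictedProduct.
Variable r : prime_nat -> nat.
Local Notation P := (rprod (fun p : prime_nat => Zp_pow p (r p))).

Lemma rprod_valMn (z : P) n p i : rprod_val (z *+ n) p i = rprod_val z p i *+ n.
Proof.
have E k : rprod_val (z *+ k) = rprod_val z *+ k.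
  by elim: k => [//|k IH]; rewrite !mulrS -IH.
by rewrite E gprodMn [LHS](gprodMn _ n i).
Qed.

(** Division by [n] preserves integrality at the primes that do not divide
    [n]. *)
Lemma rprod_divisible : divisible P.
Proof.
move=> n n0 z.
have ex p i := @Qp_divisible p n (rprod_val z p i) n0.
pose y : gprod (fun p : prime_nat => gpow (Qp p) (r p)) := fun p i =>
  sval (cid (ex p i)).
have yP p i : y p i *+ n = rprod_val z p i /\ (rprod_val z p i \in @Zp_pred p ->
    ~~ (sval p %| n)%N -> y p i \in @Zp_pred p) := svalP (cid (ex p i)).
have ya : y \in almost_in (fun p : prime_nat => Zp_pow p (r p)).
  apply/asboolP; apply: (@sub_finite_set _ _
    ([set p | rprod_val z p \notin Zp_pow p (r p)]
      `|` [set p | (sval p %| n)%N])).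
    move=> p /= ny; have [pn|pn] := boolP (sval p %| n)%N; first by right.
    left; apply: contra ny => /asboolP zp; apply/asboolP => i.
    by apply: (yP p i).2.
  rewrite finite_setU; split; first exact: asboolW (rprodP z).
  exact: finite_prime_divisors.
exists (RProd ya); apply: rprod_ext => p i; rewrite rprod_valMn.
exact: (yP p i).1.
Qed.

(** Only finitely many components fail to be integral, so one denominator
    clears them all. *)
Lemma rprod_torsion (z : P) : exists2 n, (0 < n)%N &
  forall p, rprod_val (z *+ n) p \in Zp_pow p (r p).
Proof.
have /asboolP/finite_seqP[s sE] := rprodP z.
pose Q p n := forall i, rprod_val z p i *+ n \in @Zp_pred p.
have Zd p i m n : rprod_val z p i *+ m \in @Zp_pred p -> (m %| n)%N ->
    rprod_val z p i *+ n \in @Zp_pred p.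
  by move=> mZ /dvdnP[k ->]; rewrite mulnC mulrnA; exact: rpredMn.
have [p _|p m n Qm mn i|n n0 nQ] := @common_multiple _ s Q.
- have [i _|i m n|n n0 nQ] := @common_multiple _ (enum 'I_(r p))
    (fun i n => rprod_val z p i *+ n \in @Zp_pred p).
  + exact: Qp_torsion_Zp.
  + exact: Zd.
  + by exists n => // i; apply: nQ; rewrite mem_enum.
- exact: Zd (Qm i) mn.
- exists n => // p; apply/asboolP => i; rewrite rprod_valMn.
  have [ps|ps] := boolP (p \in s); first exact: nQ.
  apply: rpredMn; suff /asboolP : rprod_val z p \in Zp_pow p (r p) by exact.
  apply/negPn/negP => zp; move/negP: ps; apply.
  by have : [set p | rprod_val z p \notin Zp_pow p (r p)] p by []; rewrite sE.
Qed.

End RestrictedProduct.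

Section Rank.
Variables (R : realType) (A : topologicalZmodType) (F : set A).
Hypotheses (sF : subgrp F) (F0 : nbhs 0 F).
Hypothesis pureF : forall a n, (0 < n)%N -> F (a *+ n) -> F a.

Definition independent_mod r (x : 'I_r -> A) : Prop :=
  forall c, F (int_comb x c) -> forall i, c i = 0.

Lemma Qdisc_divisible : divisible Qdisc.
Proof. exact: (@divisible_field rat). Qed.

(** The coefficients define a homomorphism from the group generated by [F]
    and the [x i] to Q^r; it extends to [A] because Q^r is divisible. *)
Lemma independent_coordinates r (x : 'I_r -> A) : independent_mod x ->
  exists b : A -> gpow Qdisc r, [/\ zmod_morphism b, forall a, F a -> b a = 0 &
    forall c, b (int_comb x c) = fun i => (c i)%:~R].
Proof.
move=> xi.
pose Gam := [set y : A * gpow Qdisc r | exists2 c, F (y.1 - int_comb x c) &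
  y.2 = fun i => (c i)%:~R].
have divQ : divisible (gpow Qdisc r).
  by apply: gprod_divisible => _; exact: Qdisc_divisible.
have [|b bm bG] := divisible_extend divQ (Gam := Gam).
- have c0 : int_comb x (fun=> 0) = 0 by rewrite /int_comb big1// => i _;
    rewrite mulr0z.
  split; [split|].
  + exists (fun=> 0) => //=; first by rewrite c0 subr0; exact: subgrp0.
  + move=> [a q] [a' q'] [/= c Fc ->] [/= c' Fc' ->].
    exists (fun i => c i - c' i) => /=.
      rewrite int_combB; have := subgrpB sF Fc Fc'.
      by congr F; rewrite [in LHS]opprD addrACA -opprD.
    by apply: functional_extensionality_dep => i; rewrite rmorphB.
  + move=> q [/= c Fc ->].
    have /xi c00 : F (int_comb x c) by rewrite -[int_comb x c]opprK;
      apply: (subgrpN sF); rewrite -sub0r.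
    by apply: functional_extensionality_dep => i; rewrite c00.
- exists b; split=> // [a Fa|c]; apply: bG.
    exists (fun=> 0) => //=.
    by rewrite /int_comb big1 ?subr0// => i _; rewrite mulr0z.
  by exists c => //=; rewrite subrr; exact: subgrp0.
Qed.

(** The coordinates with respect to an independent family are continuous
    because they vanish on the open subgroup [F]; viewed as real characters
    they are linearly independent, being dual to the family. *)
Lemma independent_bound n (e : 'I_n -> chom A R^o) :
  (forall v : chom A R^o, exists c : 'I_n -> R, v = \sum_(i < n) c i *: e i) ->
  forall r (x : 'I_r -> A), independent_mod x -> (r <= n)%N.
Proof.
move=> eP r x xi; have [b [bm bF bx]] := independent_coordinates xi.
have fP i : (fun a => ratr (b a i) : R^o) \in @is_chom A R^o.
  apply: hom_is_chom; first by move=> y z; rewrite bm gprodB rmorphB.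
  move=> W W0; apply: filterS F0 => a /bF /= ->.
  by rewrite gprod0 rmorph0; exact: nbhs_singleton.
have ex i := eP (Chom (fP i)).
(* If [n < r], the rows of the matrix of the coordinates in a spanning family
   satisfy a non-trivial relation [v]. *)
pose M := \matrix_(i < r, k < n) sval (cid (ex i)) k.
have ME i : Chom (fP i) = \sum_k M i k *: e k.
  rewrite {1}(svalP (cid (ex i))); apply: eq_bigr => k _; by rewrite mxE.
rewrite leqNgt; apply/negP => nr.
have kM0 : kermx M != 0.
  rewrite -mxrank_eq0 mxrank_ker subn_eq0 -ltnNge.
  exact: leq_ltn_trans (rank_leq_col M) nr.
have := nz_row_sub (kermx M); set v := nz_row _ => /sub_kermxP vM.
have v0 : v != 0 by rewrite nz_row_eq0.
move/eqP: v0; apply; apply/rowP => j; rewrite mxE.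
have sum0 : \sum_i v 0 i *: Chom (fP i) = 0 :> chom A R^o.
  under eq_bigr do rewrite ME scaler_sumr.
  rewrite exchange_big big1//= => k _.
  under eq_bigr do rewrite scalerA.
  rewrite -scaler_suml; have -> : \sum_i v 0 i * M i k = (v *m M) 0 k
    by rewrite mxE.
  by rewrite vM mxE scale0r.
have sumE (s : 'I_r -> chom A R^o) a : (\sum_i v 0 i *: s i) a = \sum_i v 0 i *
  s i a.
  by elim/big_rec2 : _ => [//|i y1 y2 _ <-].
have := congr1 (fun h : chom A R^o => h (int_comb x (fun k =>
  (k == j)%:Z))) sum0.
rewrite /= sumE (bigD1 j)//= bx eqxx rmorph1 mulr1 big1 ?addr0//.
by move=> i /negbTE ij; rewrite ij /= rmorph0 mulr0.
Qed.

(** For a maximal independent family, every element of [A] has a positive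
    multiple in the group generated by [F] and the family, on which the
    coordinates vanish only on [F]; as [A/F] is torsion-free, this holds on
    [A] too. *)
Lemma rank_coordinates : finite_dimensional (chom A R^o : lmodType R) ->
  exists r (b : A -> gpow Qdisc r), [/\ zmod_morphism b,
    forall a, b a = 0 <-> F a &
    forall q, exists2 n, (0 < n)%N & exists a, b a = q *+ n].
Proof.
move=> [n [e eP]].
have ex0 : exists r, `[< exists x : 'I_r -> A, independent_mod x >].
  by exists 0%N; apply/asboolP; exists (fun=> 0) => c _ [].
have bound r : `[< exists x : 'I_r -> A, independent_mod x >] -> (r <= n)%N.
  by move=> /asboolP[x]; exact: independent_bound eP _ x.
case: (ex_maxnP ex0 bound) => r /asboolP[x xi] rmax.
have [b [bm bF bx]] := independent_coordinates xi.
exists r, b; split=> // [a|q].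
- split=> [ba|]; last exact: bF.
  (* Enlarged by [a], the family is no longer independent; the coefficient
     of [a] in a relation cannot be 0. *)
  pose x' (i : 'I_r.+1) := if unlift ord0 i is Some j then x j else a.
  have x'E c : int_comb x' c =
      a *~ c ord0 + int_comb x (fun i => c (lift ord0 i)).
    rewrite /int_comb big_ord_recl /x' unlift_none; congr (_ + _).
    by apply: eq_bigr => i _; rewrite liftK.
  have [c [Fc cn0]] : exists c, F (int_comb x' c) /\ ~ forall i, c i = 0.
    apply: contrapT => no; suff /rmax : `[< exists x : 'I_r.+1 -> A,
      independent_mod x >].
      by rewrite ltnn.
    apply/asboolP; exists x' => c Fc; apply: contrapT => cn0.
    by apply: no; exists c.
  have c00 : c ord0 != 0.
    apply/eqP => c00; apply: cn0 => i.
    case: (unliftP ord0 i) => [j ->|->//]; move: j.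
    by apply: xi; move: Fc; rewrite x'E c00 mulr0z add0r.
  have cl : forall j, c (lift ord0 j) = 0.
    have := bF _ Fc; rewrite x'E (zmod_morphD bm) (zmod_morphMz bm) ba mul0rz
      add0r bx.
    move=> E j; have := congr1 (fun g : gpow Qdisc r => g j) E => /= /eqP.
    by rewrite intr_eq0 => /eqP.
  have : F (a *~ c ord0).
    move: Fc; rewrite x'E; have -> : int_comb x (fun i => c (lift ord0 i)) = 0.
      by rewrite /int_comb big1// => i _; rewrite cl mulr0z.
    by rewrite addr0.
  case: (c ord0) c00 => k k0; first by apply: pureF; rewrite lt0n.
  by rewrite NegzE mulrNz => /(subgrpN sF); rewrite opprK; exact: pureF.
- have [i _|i m k [z zE] /dvdnP[l ->]|k k0 kq] := @common_multiple _ (enum 'I_r)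
    (fun i k => exists z : int, (q i : rat) *+ k = z%:~R).
  + exists `|denq (q i)|%N; first by rewrite absz_gt0 denq_eq0.
    exists (numq (q i)); rewrite numqE -[LHS]mulr_natr; congr (_ * _).
    by rewrite -[LHS]/((_%:Z)%:~R) absz_denq.
  + by exists (z * l); rewrite mulnC mulrnA zE rmorphM /= -[LHS]mulr_natr.
  exists k => //; pose c i := sval (cid (kq i (mem_enum _ i))).
  exists (int_comb x c); rewrite bx; apply: functional_extensionality_dep => i.
  by rewrite gprodMn /c; case: cid.
Qed.

End Rank.

(** * Codivisible groups without compact connected part *)

(** When the connected part is 0, the group [F/S] is [F] itself, and [F] is
    open because [A/F] is discrete. *)
Lemma canonical_chain_split (R : realType) (A : topologicalZmodType)
    (S F : zmodClosed A) : canonical_chain R S F -> [set` S] = [set 0] ->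
  [/\ nbhs (0 : A) [set` F], forall a n, (0 < n)%N -> a *+ n \in F -> a \in F &
    exists (m : nat) (T : topologicalZmodType)
        (al : chom (dsum (gpow R m) T) A),
      [/\ LCA T, topological_torsion T, open_embedding al &
        forall a, a \in F <-> exists y, al y = a]].
Proof.
move=> [_ _ [dF tF] [m [T [lT ttT [f [g [fg gf]]]]]]] S0.
have F0 : nbhs (0 : A) [set` F].
  have : nbhs (gproj F 0) [set 0] by apply: open_nbhs_nbhs; split;
    [exact: dF|exact: gproj0].
  by move=> /gproj_near; apply: filterS => a /gproj_eq0.
split=> // [a n n0 anF|].
  by apply/gproj_eq0/(tF _ n n0); rewrite -gprojMn; apply/gproj_eq0.
have pi : injective (gproj (subgroup_in S F)).
  move=> x y /gproj_eq; rewrite unfold_in => xyS.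
  have : [set` S] (sgval (x - y)) by [].
  rewrite S0 /= => /(@val_inj _ _ (subgroup F) (x - y) 0) /eqP.
  by rewrite subr_eq0 => /eqP.
have reprE x : repr (gproj (subgroup_in S F) x) = x by apply: pi; exact: reprK.
pose al y := sgval (repr (g y)).
have alm : zmod_morphism al.
  move=> y z; rewrite /al chomB; have [u <-] := gproj_surj (g y).
  by have [v <-] := gproj_surj (g z); rewrite -gprojB !reprE.
have alF y : al y \in F by exact: sgvalP.
have alf (x : subgroup F) : al (f (gproj (subgroup_in S F) x)) = sgval x.
  by rewrite /al fg reprE.
have al_inj : injective al.
  move=> y z /(@val_inj _ _ (subgroup F)) E; apply: (can_inj gf).
  by rewrite -[g y]reprK -[g z]reprK E.
have alc : al \in @is_chom (dsum (gpow R m) T) A.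
  apply: hom_is_chom => // W W0.
  have : nbhs (0 : gquot (subgroup_in S F)) [set q | W (sgval (repr q))].
    rewrite -(gproj0 (subgroup_in S F)); apply/gproj_near/subgroup_nearP.
    by exists W => // x Wx; rewrite /= reprE.
  by move=> /(chom_near0 g).
exists m, T, (Chom alc); split=> // [|a]; last first.
  split=> [aF|[y <-]]; last exact: alF.
  by exists (f (gproj (subgroup_in S F) (Subgroup aF))); exact: alf.
split=> // [|U oU]; first exact: chom_continuous.
apply: hom_open => // V /(chom_near0 f).
rewrite -(gproj0 (subgroup_in S F)) => /gproj_near/subgroup_nearP[W W0 WV].
apply: filterS (filterI W0 F0) => a [Wa aF].
exists (f (gproj (subgroup_in S F) (Subgroup aF))); last exact: alf.
exact: (WV (Subgroup aF)).
Qed.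

Lemma mul_open_summand (A B T : topologicalZmodType)
    (al : chom (dsum B T) A) n :
  open_embedding al -> mul_open A n -> mul_open T n.
Proof.
move=> eal mA V V0; have [_ ali _] := eal.
have BV : nbhs (0 : dsum B T) [set y | V y.2].
  by apply/dsum_near0; exists setT, V; split=> // [|y []]; first exact: filterT.
have := chom_near0 al (mA _ (open_map_near0 eal BV)).
move=> /dsum_near0[P [Q [P0 Q0 PQ]]]; apply: filterS Q0 => t Qt.
have [|_ [y Vy <-] yt] := PQ (0, t); first by split=> //; exact: nbhs_singleton.
exists y.2 => //; move: yt; rewrite -(zmod_morphMn (chomB al)) => /ali.
by rewrite dsumMn => -[].
Qed.

Section Split.
Variables (R : realType) (A T : topologicalZmodType) (m : nat).
Variables (al : chom (dsum (gpow R m) T) A) (F : zmodClosed A).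
Hypotheses (eal : open_embedding al) (alF : forall a, a \in F <-> exists y,
  al y = a).
Hypothesis pureF : forall a n, (0 < n)%N -> a *+ n \in F -> a \in F.
Variable U : set T.
Hypotheses (sU : subgrp U) (U0 : nbhs 0 U).

Let al_inj : injective al. Proof. by case: eal. Qed.

(** A torsion element [a] lies in [F] and in fact in [T], as [A/F] and R^m
    are torsion-free. If [a != 0] some open subgroup R^m + kU misses [a], and
    the discrete quotient has a character which is not 0 at [a]. Being of the
    form [psi *+ n] with [a *+ n = 0], it must however vanish at [a]. *)
Lemma codivisible_torsionfree : codivisible R A ->
  (forall n, (0 < n)%N -> mul_open T n) -> hausdorff_space T ->
  (forall W : set T, nbhs 0 W ->
    exists2 n, (0 < n)%N & forall u, U u -> W (u *+ n)) ->
  torsionfree A.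
Proof.
move=> codA mT hT unifU a n n0 an0; apply: contrapT => /eqP a0.
have /alF[[x t] xta] : a \in F by apply: (pureF n0); rewrite an0 rpred0.
have : ((x, t) : dsum (gpow R m) T) *+ n = 0.
  by apply: al_inj; rewrite (zmod_morphMn (chomB al)) xta an0 chom0.
rewrite dsumMn => -[xn0 _].
have x0 : x = 0.
  apply: functional_extensionality_dep => i;
    have := congr1 (fun z : gpow R m => z i) xn0.
  rewrite gprodMn => /eqP; rewrite mulrn_eq0 -leqn0 leqNgt n0 /= => /eqP; exact.
have t0 : t != 0 by apply: contra a0 => /eqP t0; rewrite -xta x0 t0 chom0.
have [W W0 Wt] := hausdorff_separates0 hT t0.
have [k k0 kW] := unifU W W0.
pose O := [set a | exists y, [/\ al y = a & multiples U k y.2]].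
have sk := multiples_subgrp sU k.
have sO : subgrp O.
  split; first by exists 0; split; [exact: chom0|exact: (subgrp0 sk)].
  move=> _ _ [y [<- Uy]] [z [<- Uz]]; exists (y - z); split; first exact: chomB.
  exact: (subgrpB sk).
have O0 : nbhs (0 : A) O.
  have : nbhs (0 : dsum (gpow R m) T) [set y | multiples U k y.2].
    apply/dsum_near0; exists setT, (multiples U k); split.
    - exact: filterT.
    - exact: mT.
    - by move=> y [].
  by move=> /(open_map_near0 eal); apply: filterS => _ [y Uy <-]; exists y.
have nOa : ~ O a.
  move=> [y [ya [u Uu uy]]]; apply: Wt; suff -> : t = u *+ k by exact: kW.
  by move: ya; rewrite -xta => /al_inj yxt; rewrite uy yxt.
have q0 : gproj (subgrp_pred sO) a != 0.
  by apply/eqP => /gproj_eq0/subgrp_predP.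
have [h hm h0] := character_separates R q0.
have chiP : (fun b => h (gproj (subgrp_pred sO) b)) \in @is_chom A (circle R).
  apply: hom_is_chom; first by move=> b c; rewrite gprojB hm.
  move=> V V0; apply: filterS O0 => b Ob /=.
  have -> : gproj (subgrp_pred sO) b = 0 by apply/gproj_eq0/subgrp_predP.
  by rewrite (zmod_morph0 hm); exact: nbhs_singleton.
have [psi psiE] := codA n n0 (Chom chiP : dual R A).
have E k' : (psi *+ k' : dual R A) a = psi a *+ k'.
  by elim: k' => [//|k' IH]; rewrite !mulrS -IH.
have := congr1 (fun g : dual R A => g a) psiE;
  rewrite E -(zmod_morphMn (chomB psi)) an0 chom0.
by move=> /= /esym/eqP; rewrite (negbTE h0).
Qed.

Section Coordinates.
Variables (r : prime_nat -> nat).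
Local Notation P := (rprod (fun p : prime_nat => Zp_pow p (r p))).
Variable phi : T -> P.
Hypotheses (phiB : forall u v, U u -> U v -> phi (u - v) = phi u - phi v)
  (phi0 : forall u, U u -> phi u = 0 -> u = 0)
  (phi_near : forall W, nbhs 0 W -> nbhs 0 [set u | W (phi u)])
  (phi_open : forall V, nbhs 0 V -> nbhs 0 [set phi u | u in U `&` V])
  (phi_surj : forall z : P,
        (forall p, rprod_val z p \in Zp_pow p (r p)) -> exists2 u, U u &
          phi u = z).
Hypothesis tfA : torsionfree A.
Hypothesis torT : forall t : T, exists2 n, (0 < n)%N & U (t *+ n).

(** The coordinates on the open subgroup R^m + U extend to [A] because the
    target is divisible. *)
Lemma split_coordinates : exists h : A -> dsum (gpow R m) P,
  zmod_morphism h /\ forall x u, U u -> h (al (x, u)) = (x, phi u).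
Proof.
have divD : divisible (dsum (gpow R m) P).
  apply: dsum_divisible; last exact: rprod_divisible.
  by apply: gprod_divisible => _; exact: divisible_field.
have p00 : phi 0 = 0.
  by rewrite -(subrr 0) phiB ?subrr//; exact: (subgrp0 sU).
pose Gam := [set y : A * dsum (gpow R m) P | exists x u,
  [/\ U u, y.1 = al (x, u) & y.2 = (x, phi u)]].
have [|h hm hG] := divisible_extend divD (Gam := Gam).
  split; [split|].
  - exists 0, 0; split; [exact: (subgrp0 sU)|exact/esym/chom0|by rewrite p00].
  - move=> [a d] [a' d'] [x [u [/= Uu -> ->]]] [x' [u' [/= Uu' -> ->]]].
    exists (x - x'), (u - u'); split;
      [exact: (subgrpB sU)|by rewrite /= -chomB|].
    by rewrite phiB.
  - move=> d [x [u [/= Uu /esym xu0 ->]]].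
    have [-> ->] : (x, u) = 0 :> dsum (gpow R m) T by apply: al_inj;
      rewrite xu0 chom0.
    by rewrite p00.
by exists h; split=> // x u Uu; apply: hG; exists x, u.
Qed.

Section Rank.
Variables (s : nat) (b : A -> gpow Qdisc s).
Hypotheses (bm : zmod_morphism b) (b0 : forall a, b a = 0 <-> a \in F)
  (b_tor : forall q, exists2 n, (0 < n)%N & exists a, b a = q *+ n).

(** The map is injective: [b] vanishes only on [F], and the second component
    is injective on R^m + U, which has torsion index in [F], while [A] is
    torsion-free. It is open since R^m + U is mapped homeomorphically onto an
    open subgroup; this uses that Q^s is discrete. Its cokernel is torsion
    because this already holds for [b] and for the subgroup of integral
    elements of the restricted product. *)
Lemma split_embedding : LCA A ->
  exists f : chom A (QRQp R s m r), divisible_extension f.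
Proof.
move=> lA; have [h [hm hE]] := split_coordinates.
pose f a : QRQp R s m r := (b a, h a).
have bal y : b (al y) = 0 by apply/b0/alF; exists y.
have fm : zmod_morphism f by move=> x y; rewrite /f bm hm.
have fc : f \in @is_chom A (QRQp R s m r).
  apply: hom_is_chom => // W /dsum_near0[W1 [W' [W10 /dsum_near0[W2 [W3 [W20
    W30 W23]]] WW]]].
  have : nbhs (0 : dsum (gpow R m) T) [set y | W2 y.1 /\ (W3 (phi y.2) /\ U
    y.2)].
    apply/dsum_near0; exists W2, [set u | W3 (phi u) /\ U u]; split=> //.
    by apply: filterI => //; exact: phi_near.
  move=> /(open_map_near0 eal); apply: filterS => _ [[x u] /= [W2x [W3u Uu]]
    <-].
  apply: WW; split=> /=; first by rewrite bal; exact: nbhs_singleton.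
  by apply: W23; rewrite hE.
exists (Chom fc).
have divE : divisible (QRQp R s m r).
  apply: dsum_divisible; first by apply: gprod_divisible => _;
    exact: Qdisc_divisible.
  apply: dsum_divisible; last exact: rprod_divisible.
  by apply: gprod_divisible => _; exact: divisible_field.
have ef : open_embedding (Chom fc).
  split; first exact: chom_continuous.
  - apply: (hom_inj fm) => a [ba ha].
    have /alF[[x t] xta] : a \in F by apply/b0.
    have [n n0 Un] := torT t; apply: (tfA n0).
    have yE : ((x, t) : dsum (gpow R m) T) *+ n = (x *+ n, t *+ n)
      by exact: dsumMn.
    have : h (a *+ n) = 0 by rewrite (zmod_morphMn hm) ha mul0rn.
    rewrite -xta -(zmod_morphMn (chomB al)) yE hE// => -[-> /(phi0 Un) ->].
    exact: chom0.
  - apply: hom_open => // V V0; have := chom_near0 al V0.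
    move=> /dsum_near0[V1 [V2 [V10 V20 V12]]].
    apply/dsum_near0; exists [set 0], (V1 `*` [set phi u | u in U `&` V2]);
      split.
    + have Q0 : nbhs (0 : gpow Qdisc s) [set q : gpow Qdisc s | forall i,
        q i = 0].
        apply: (@filter_forall _ _ (fun i =>
          [set q : gpow Qdisc s | q i = 0]) (nbhs 0) _) => i.
        exact: (@gprod_proj_near _ (fun=> Qdisc) 0 i [set 0]).
      apply: filterS Q0 => q q0; exact: functional_extensionality_dep.
    + apply/dsum_near0; exists V1, [set phi u | u in U `&` V2]; split=> //.
      exact: phi_open.
    + move=> [q [x z]] /= [-> [V1x [u [Uu V2u] <-]]].
      exists (al (x, u)); first exact: (V12 (x, u)).
      by rewrite /f bal hE.
split=> //; first exact: LCA_open_embedding ef.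
move=> Q; have [[q [x z]] <-] := gproj_surj Q.
have [n n0 [a ba]] := b_tor q.
(* Some multiple of what is left after subtracting the image of [a] comes from
   R^m + U. *)
have [k k0 kZ] := rprod_torsion (z *+ n - (h a).2).
have [u Uu uE] := phi_surj kZ.
exists (n * k)%N; first by rewrite muln_gt0 n0.
rewrite -gprojMn; apply/gproj_eq0/asboolP.
exists (a *+ k + al ((x *+ n - (h a).1) *+ k, u)).
rewrite /= /f (zmod_morphD bm) (zmod_morphD hm) (zmod_morphMn bm) (zmod_morphMn
  hm).
rewrite bal addr0 hE// uE ba -mulrnA.
rewrite [RHS]dsumMn /=; congr (_, _); rewrite [RHS]dsumMn [h a *+ k]dsumMn /=.
congr (_, _) => /=.
  by rewrite mulrnBl -mulrnA addrC subrK.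
by rewrite mulrnBl -mulrnA addrC subrK.
Qed.

End Rank.
End Coordinates.
End Split.

Lemma in_P_embedding (R : realType) (A : topologicalZmodType) : in_P R A ->
  exists (r s : nat) (rp : prime_nat -> nat) (f : chom A (QRQp R r s rp)),
    divisible_extension f.
Proof.
move=> [[lA frA] codA [S [F [chain S0]]]].
have [F0 pureF [m [T [al [lT ttT eal alF]]]]] := canonical_chain_split chain S0.
have mT n : (0 < n)%N -> mul_open T n.
  by move=> n0; apply: (mul_open_summand eal);
    exact: (finite_ranks_mul_open frA).
have [U [sU U0 cU]] := compact_open_subgroup lT ttT.
have unifU W : nbhs (0 : T) W -> exists2 n, (0 < n)%N & forall u, U u ->
  W (u *+ n).
  move=> /(uniform_torsion ttT sU U0 cU)[k _ /(_ k (leqnn k)) kW].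
  by exists k`! => //; exact: fact_gt0.
have tfA := codivisible_torsionfree eal alF pureF sU U0 codA mT lT.1 unifU.
have tfT : torsionfree T.
  move=> t n n0 tn; have [_ ali _] := eal.
  have : al (0, t) = 0.
    apply: (tfA _ n n0); rewrite -(zmod_morphMn (chomB al)) dsumMn /= tn mul0rn.
    exact: chom0.
  by move=> /(fun e => ali _ _ (etrans e (esym (chom0 al)))) [].
have [rp [phi [phiB phi0 phi_near phi_open phi_surj]]] :=
  profinite_coordinates sU U0 cU mT tfT lT.1 unifU.
have torT (t : T) : exists2 n, (0 < n)%N & U (t *+ n).
  by have [k _ /(_ k (leqnn k)) kU] := ttT t _ U0; exists k`! => //;
    exact: fact_gt0.
have [fdA _ _] := frA.
have [s [b [bm b0 btor]]] :=
  rank_coordinates (zmodClosed_subgrp F) F0 pureF fdA.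
exists s, m, rp.
exact: (split_embedding eal alF sU U0 phiB phi0 phi_near phi_open phi_surj tfA
  torT bm b0 btor lA).
Qed.

Theorem proposition3p8 (R : realType) (A : topologicalZmodType) (hA : LCA A) :
  (exists (D : topologicalZmodType) (f : chom A D), divisible_extension f)
  /\
  (FLCAb R A ->
   exists (D : topologicalZmodType) (f : chom A D),
     FLCAb R D /\ divisible_extension f)
  /\
  (in_P R A ->
   exists (r s : nat) (rp : prime_nat -> nat) (f : chom A (QRQp R r s rp)),
     divisible_extension f).
Proof.
split; [|split].
- by have [D [f [Df _]]] := LCA_divisible_hull R hA; exists D, f.
- move=> [_ frA]; have [D [f [Df essf]]] := LCA_divisible_hull R hA.
  have [lD divD ef _] := Df; exists D, f; split=> //; split=> //.
  exact: (extension_finite_ranks frA divD ef essf).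
- exact: in_P_embedding.
Qed.
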